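(* Let $0<p<\infty$ and let $\alpha$ be a cardinal number with $\alpha\le\mathfrak{c}$. The set $$L_{p}[0,1]\smallsetminus\bigcup_{q\in(p,\infty)}L_{q}[0,1]$$ is $(\alpha,\mathfrak{c})$-spaceable in $L_{p}[0,1]$ if, and only if, $\alpha<\aleph_{0}$.
   Context: All vector spaces are over a fixed scalar field $\mathbb{K}$, which is either $\mathbb{R}$ or $\mathbb{C}$. Write $\mathfrak{c}=\operatorname{card}(\mathbb{R})$ and $\aleph_0=\operatorname{card}(\mathbb{N})$. Here $\dim$ denotes the algebraic (Hamel) dimension. For an interval $I\subset\mathbb{R}$ and $0<p<\infty$, $L_p(I)$ is the vector space of (Lebesgue classes, i.e. modulo equality almost everywhere, of) measurable functions $f\colon I\to\mathbb{K}$ such that $|f|^p$ is Lebesgue integrable on $I$. It is endowed with the topology given by $\|f\|_p=\left(\int_I|f|^p\right)^{1/p}$, which is a norm making it a Banach space if $p\ge 1$, and a $p$-norm making it a quasi-Banach space if $0<p<1$. $L_p[0,1]$ denotes $L_p(I)$ with $I=[0,1]$. Let $E$ be a vector space and $A\subset E$. For a cardinal $\alpha\le\dim(E)$, $A$ is called $\alpha$-lineable if there is a vector subspace $F\subset E$ with $\dim(F)=\alpha$ and $F\smallsetminus\{0\}\subset A$. If $E$ is endowed with a topology and $\alpha\le\beta\le\dim(E)$ are cardinals, $A$ is called $(\alpha,\beta)$-spaceable (in $E$) if $A$ is $\alpha$-lineable and, for every subspace $F_\alpha\subset E$ with $F_\alpha\subset A\cup\{0\}$ and $\dim(F_\alpha)=\alpha$,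 there is a closed subspace $F_\beta\subset E$ with $\dim(F_\beta)=\beta$ and $F_\alpha\subset F_\beta\subset A\cup\{0\}$. *)

(* Defs.v *)
From HB Require Import structures.
From mathcomp Require Import all_boot all_order all_algebra.
From mathcomp Require Import generic_quotient ring_quotient.
From mathcomp Require Import complex.
From mathcomp Require Import all_classical all_reals all_analysis.
From mathcomp Require Import measurable_realfun.

Set Implicit Arguments.
Unset Strict Implicit.
Unset Printing Implicit Defensive.

Import Order.TTheory GRing.Theory Num.Theory.
Import numFieldNormedType.Exports.

Local Open Scope classical_set_scope.
Local Open Scope card_scope.
Local Open Scope quotient_scope.
Local Open Scope ring_scope.

Definition card_lt T U (A : set T) (B : set U) := (A #<= B) && (A #!= B).
Notation "A '#<' B" := (card_lt A B) (at level 79) : card_scope.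

(* A cardinal number is represented by any set [alpha : set T] of that        *)
(* cardinality; [T] is arbitrary, and all notions below depend on [alpha]     *)
(* only up to equipotence.                                                    *)
Section Lineability.
Context {K : numFieldType}.

Section Algebraic.
Context {E : lmodType K}.
Implicit Types (F B A : set E).

Definition vector_subspace F := submod_closed [in F].

Definition lin_indep B := forall (s : seq E) (c : E -> K),
  uniq s -> [set` s] `<=` B ->
  \sum_(x <- s) c x *: x = 0 -> forall x, x \in s -> c x = 0.

Definition lin_span B : set E := [set y | exists (s : seq E) (c : E -> K),
  [set` s] `<=` B /\ y = \sum_(x <- s) c x *: x].

Definition hamel_basis F B := lin_indep B /\ lin_span B = F.

Definition has_dim T F (alpha : set T) :=
  exists B, hamel_basis F B /\ B #= alpha.

Definition lineable T (alpha : set T) A := exists F,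
  [/\ vector_subspace F, has_dim F alpha & F `\ 0 `<=` A].

End Algebraic.

Definition spaceable {E : preTopologicalLmodType K} T U
    (alpha : set T) (beta : set U) (A : set E) :=
  lineable alpha A /\
  forall Fa : set E, vector_subspace Fa -> Fa `<=` A `|` [set 0] ->
    has_dim Fa alpha ->
    exists Fb : set E, [/\ vector_subspace Fb, closed Fb, has_dim Fb beta,
      Fa `<=` Fb & Fb `<=` A `|` [set 0]].

End Lineability.

Variant scalar_kind := RealScalars | ComplexScalars.

Section Scalars.
Variable R : realType.

Definition scalar_field (k : scalar_kind) : numFieldType :=
  match k with RealScalars => R | ComplexScalars => R[i] end.

Definition modulus {k : scalar_kind} : scalar_field k -> R :=
  match k with
  | RealScalars => fun x : R => `|x|
  | ComplexScalars => fun z : R[i] => ComplexField.Normc.normc z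
  end.

Lemma modulus_ge0 k (x : scalar_field k) : 0 <= modulus x.
Proof. by case: k x => //= -[a b] /=; exact: sqrtr_ge0. Qed.

Lemma modulus0 k : modulus (0 : scalar_field k) = 0.
Proof.
by case: k; [exact: (@normr0 R R)|exact: (@ComplexField.Normc.normc0 R)].
Qed.

Lemma modulusM k (x y : scalar_field k) :
  modulus (x * y) = modulus x * modulus y.
Proof.
by case: k x y; [exact: (@normrM R)|exact: (@ComplexField.Normc.normcM R)].
Qed.

Lemma modulusD k (x y : scalar_field k) :
  modulus (x + y) <= modulus x + modulus y.
Proof.
case: k x y => x y; first exact: (@ler_normD R R).
have := ler_normD (x : R[i]) y.
rewrite !normc_def -rmorphD/= lecR.
by case: x y => [a b] [c e].
Qed.

End Scalars.

Lemma measurable_lincomb d (T : measurableType d) (R : realType) (D : set T)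
    (a b : R) (u v w : T -> R) :
  measurable_fun D u -> measurable_fun D v -> measurable_fun D w ->
  measurable_fun D (fun t => a * u t + b * v t + w t).
Proof.
move=> mu mv mw; apply: measurable_funD mw; apply: measurable_funD.
  exact: measurable_funM (measurable_cst _) mu.
exact: measurable_funM (measurable_cst _) mv.
Qed.

Lemma ae_integrable d (T : measurableType d) (R : realType)
    (mu : {measure set T -> \bar R}) (D : set T) (f g : T -> \bar R) :
  measurable D -> measurable_fun D g -> ae_eq mu D f g ->
  mu.-integrable D f -> mu.-integrable D g.
Proof.
move=> mD mg fg /integrableP[mf fi]; apply/integrableP; split=> //.
apply: le_lt_trans fi; rewrite le_eqVlt; apply/orP; left; apply/eqP.
apply: ae_eq_integral => //; try exact: measurableT_comp.
by apply: filterS fg => t /[apply] ->.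
Qed.

Section Lebesgue.
Variables (R : realType) (k : scalar_kind).
Notation K := (scalar_field R k).
Notation mu := (@completed_lebesgue_measure R).
(* the copy of [R] carrying the sigma-algebra of Lebesgue measurable sets *)
Notation lebR := (caratheodory_type (wlength idfun)^*%mu).

Lemma measurable_lebR (D : set R) :
  measurable D -> measurable (D : set lebR).
Proof. by move=> mD; exact: sub_caratheodory. Qed.

(* The functions live on all of [R], but only their values on the interval    *)
(* under consideration matter: measurability, almost everywhere equality and  *)
(* integrability are all relative to it.                                      *)
Definition lebesgue_measurable (D : set R) : (R -> K) -> Prop :=
  match k return (R -> scalar_field R k) -> Prop with
  | RealScalars => fun f : R -> R =>
      measurable_fun (D : set lebR) (f : lebR -> R)
  | ComplexScalars => fun f : R -> R[i] =>
      measurable_fun (D : set lebR) (fun t : lebR => complex.Re (f t)) /\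
      measurable_fun (D : set lebR) (fun t : lebR => complex.Im (f t))
  end.

Implicit Types (I : interval R) (f g : R -> K^o).

Lemma lebesgue_measurableZD (D : set R) (a : K) f g :
  lebesgue_measurable D f -> lebesgue_measurable D g ->
  lebesgue_measurable D (a *: f + g).
Proof.
rewrite /lebesgue_measurable; case: k a f g => /= a f g.
  move=> mf mg; apply: measurable_funD => //.
  by apply: measurable_funM => //; exact: measurable_cst.
move=> [f1 f2] [g1 g2]; split.
  rewrite (_ : (fun t => _) = (fun t : lebR => complex.Re a * complex.Re (f t)
    + (- complex.Im a) * complex.Im (f t) + complex.Re (g t))).
    exact: measurable_lincomb.
  apply/funext => t; rewrite mulNr /= /GRing.add /= /GRing.scale /=.
  by case: a => ? ?; case: (f t) => ? ?; case: (g t).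
rewrite (_ : (fun t => _) = (fun t : lebR => complex.Re a * complex.Im (f t)
    + complex.Im a * complex.Re (f t) + complex.Im (g t))).
  exact: measurable_lincomb.
apply/funext => t; rewrite /GRing.add /= /GRing.scale /=.
by case: a => ? ?; case: (f t) => ? ?; case: (g t).
Qed.

Lemma lebesgue_measurable0 (D : set R) : lebesgue_measurable D (0 : R -> K^o).
Proof.
rewrite /lebesgue_measurable; case: k; first exact: measurable_cst.
by split; exact: measurable_cst.
Qed.

Lemma measurable_modulus (D : set R) f : measurable D ->
  lebesgue_measurable D f ->
  measurable_fun (D : set lebR) (fun t : lebR => modulus (f t)).
Proof.
move=> mD; rewrite /lebesgue_measurable; case: k f => /= f.
  by move=> mf; exact: measurableT_comp.
move=> [f1 f2].
rewrite (_ : (fun t => _) = (fun t : lebR =>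
   Num.sqrt (complex.Re (f t) ^+ 2 + complex.Im (f t) ^+ 2))); last first.
  by apply/funext => t /=; case: (f t).
apply: (@measurableT_comp _ _ _ _ _ _ (@Num.sqrt R)).
  apply: continuous_measurable_fun; exact: sqrt_continuous.
by apply: measurable_funD; apply: measurable_funX.
Qed.

Definition mfunK I : {pred R -> K^o} :=
  mem [set f | lebesgue_measurable [set` I] f].

Lemma mfunK_submod_closed I : submod_closed (mfunK I).
Proof.
split; first by apply/mem_set; exact: lebesgue_measurable0.
move=> a f g /set_mem mf /set_mem mg.
by apply/mem_set; exact: lebesgue_measurableZD.
Qed.

HB.instance Definition _ I :=
  GRing.isSubmodClosed.Build K (R -> K^o) (mfunK I) (mfunK_submod_closed I).

Record Mfun I := MkMfun {
  Mfun_val :> R -> K^o ;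
  Mfun_prop : Mfun_val \in mfunK I }.

HB.instance Definition _ I := [isSub for @Mfun_val I].
HB.instance Definition _ I := [Choice of Mfun I by <:].
HB.instance Definition _ I := [SubChoice_isSubLmodule of Mfun I by <:].

Definition null_fun I : {pred Mfun I} :=
  mem [set f : Mfun I | {ae mu, forall t : lebR, [set` I] t -> f t = 0}].
Arguments null_fun I : clear implicits.

Lemma null_funZ I (a : K) (f : Mfun I) :
  f \in null_fun I -> a *: f \in null_fun I.
Proof.
move=> /set_mem f0; apply/mem_set => /=; apply: filterS f0 => t /[apply] ft0.
by change (a *: Mfun_val f t = 0); rewrite ft0 scaler0.
Qed.

Lemma null_fun_zmod_closed I : zmod_closed (null_fun I).
Proof.
split; first by apply/mem_set => /=; apply: aeW.
move=> f g /set_mem f0 /set_mem g0; apply/mem_set => /=.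
apply: filterS2 f0 g0 => t + + It => /(_ It) ft /(_ It) gt.
by change (Mfun_val f t - Mfun_val g t = 0); rewrite ft gt subr0.
Qed.

HB.instance Definition _ I :=
  GRing.isZmodClosed.Build (Mfun I) (null_fun I) (null_fun_zmod_closed I).

(* all measurable functions modulo equality almost everywhere on [I]; every   *)
(* L_p(I) below is a subset of this one space                                 *)
Definition L0 I := Quotient.quot (null_fun I).
HB.instance Definition _ I := GRing.Zmodule.on (L0 I).
HB.instance Definition _ I := EqQuotient.on (L0 I).

Lemma L0_eqP I (f g : Mfun I) :
  reflect (\pi_(L0 I) f = \pi_(L0 I) g) (f - g \in null_fun I).
Proof. by rewrite Quotient.idealrBE; exact: eqP. Qed.

Lemma L0_addE I (f g : Mfun I) : \pi_(L0 I) (f + g) = \pi f + \pi g :> L0 I.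
Proof. exact: Quotient.pi_add. Qed.

Lemma L0_zeroE I : \pi_(L0 I) (0 : Mfun I) = 0 :> L0 I.
Proof.
by apply: (addrI (\pi_(L0 I) (0 : Mfun I))); rewrite addr0 -L0_addE addr0.
Qed.

Definition L0_scale I (a : K) (x : L0 I) : L0 I := \pi_(L0 I) (a *: repr x).

Lemma pi_L0_scale I (a : K) (f : Mfun I) :
  L0_scale a (\pi_(L0 I) f) = \pi_(L0 I) (a *: f).
Proof.
apply/L0_eqP; rewrite -scalerBr; apply: null_funZ; apply/L0_eqP.
exact: reprK.
Qed.

Lemma L0_scaleA I (a b : K) (x : L0 I) :
  L0_scale a (L0_scale b x) = L0_scale (a * b) x.
Proof. by rewrite -[x]reprK (pi_L0_scale b (repr x)) !pi_L0_scale scalerA. Qed.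

Lemma L0_scale1 I : left_id (1 : K) (@L0_scale I).
Proof. by move=> x; rewrite -[x]reprK pi_L0_scale scale1r. Qed.

Lemma L0_scaleDr I : right_distributive (@L0_scale I) +%R.
Proof.
move=> a x y; rewrite -[x]reprK -[y]reprK -L0_addE !pi_L0_scale -L0_addE.
by rewrite scalerDr.
Qed.

Lemma L0_scaleDl I (x : L0 I) :
  {morph (@L0_scale I)^~ x : a b / a + b}.
Proof.
by move=> a b; rewrite -[x]reprK !pi_L0_scale -L0_addE scalerDl.
Qed.

HB.instance Definition _ I := GRing.Zmodule_isLmodule.Build K (L0 I)
  (@L0_scaleA I) (@L0_scale1 I) (@L0_scaleDr I) (@L0_scaleDl I).

Definition p_integrable I (p : R) (f : R -> K) :=
  mu.-integrable ([set` I] : set lebR)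
    (fun t : lebR => (modulus (f t) `^ p)%:E).

Lemma measurable_modulus_powR I (p : R) (f : Mfun I) :
  measurable_fun ([set` I] : set lebR)
    (fun t : lebR => (modulus (f t) `^ p)%:E).
Proof.
apply/measurable_EFinP.
apply: (@measurableT_comp _ _ _ _ _ _ (@powR R ^~ p)).
  exact: measurable_powR.
apply: measurable_modulus; last exact/set_mem/Mfun_prop.
exact: measurable_itv.
Qed.

Lemma p_integrable_ae I (p : R) (f g : Mfun I) :
  f - g \in null_fun I -> p_integrable I p f -> p_integrable I p g.
Proof.
have mI : measurable ([set` I] : set lebR).
  by apply: measurable_lebR; exact: measurable_itv.
move=> /set_mem fg0; apply: (ae_integrable mI (measurable_modulus_powR p g)).
apply: filterS fg0 => t /[apply] fg; congr (modulus _ `^ p)%:E.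
by apply/eqP; rewrite -subr_eq0; apply/eqP.
Qed.

Lemma p_integrable0 I (p : R) : 0 < p -> p_integrable I p (0 : Mfun I).
Proof.
move=> p0; rewrite /p_integrable (_ : (fun t => _) = cst 0%E).
  exact: integrable0.
by apply/funext => t /=; rewrite modulus0 powR0// gt_eqF.
Qed.

Lemma p_integrableZD I (p : R) (a : K) (f g : Mfun I) : 0 < p ->
  p_integrable I p f -> p_integrable I p g -> p_integrable I p (a *: f + g).
Proof.
move=> p0 fi gi.
have mI : measurable ([set` I] : set lebR).
  by apply: measurable_lebR; exact: measurable_itv.
have hi : mu.-integrable ([set` I] : set lebR) (fun t : lebR =>
    ((2 `^ p * modulus a `^ p)%:E * (modulus (f t) `^ p)%:E
     + (2 `^ p)%:E * (modulus (g t) `^ p)%:E)%E).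
  by apply: integrableD => //; exact: integrableZl.
apply: (le_integrable mI (measurable_modulus_powR p _) _ hi).
move=> t It; rewrite -!EFinM -EFinD !abse_EFin lee_fin.
rewrite ger0_norm ?powR_ge0// ger0_norm; last first.
  by rewrite addr_ge0// !mulr_ge0 ?powR_ge0.
change (modulus (a * f t + g t) `^ p <=
  2 `^ p * modulus a `^ p * modulus (f t) `^ p + 2 `^ p * modulus (g t) `^ p).
rewrite -mulrA -powRM ?modulus_ge0// -modulusM -mulrDr.
set u := modulus (a * f t); set v := modulus (g t).
have u0 : 0 <= u by exact: modulus_ge0.
have v0 : 0 <= v by exact: modulus_ge0.
have m0 : 0 <= Num.max u v by rewrite le_max u0.
apply: (@le_trans _ _ ((2 * Num.max u v) `^ p)).
  apply: ge0_ler_powR; rewrite ?nnegrE ?modulus_ge0 ?mulr_ge0//.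
    exact: ltW.
  apply: le_trans (modulusD _ _) _; rewrite -/u -/v mulr2n mulrDl mul1r.
  by rewrite lerD// le_max lexx ?orbT.
rewrite powRM// ler_wpM2l ?powR_ge0//.
by case: (leP u v) => _; rewrite ?lerDr ?lerDl powR_ge0.
Qed.

(* independent of the representative by [p_integrable_ae] *)
Definition Lp_set I (p : R) : set (L0 I) :=
  [set x | p_integrable I p (repr x : Mfun I)].
Arguments Lp_set I p : clear implicits.

Definition Lp_pred I (p : {posnum R}) : {pred L0 I} := mem (Lp_set I p%:num).

Lemma Lp_submod_closed I p : submod_closed (@Lp_pred I p).
Proof.
split.
  apply/mem_set => /=; apply: p_integrable_ae (p_integrable0 I (gt0 p)).
  by apply/L0_eqP; rewrite reprK L0_zeroE.
move=> a x y /set_mem xi /set_mem yi; apply/mem_set => /=.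
apply: p_integrable_ae (p_integrableZD a (gt0 p) xi yi).
apply/L0_eqP; rewrite reprK L0_addE reprK; congr (_ + _).
Qed.

HB.instance Definition _ I p :=
  GRing.isSubmodClosed.Build K (L0 I) (@Lp_pred I p) (@Lp_submod_closed I p).

Record Lp I p := MkLp {
  Lp_val :> L0 I ;
  Lp_prop : Lp_val \in @Lp_pred I p }.

HB.instance Definition _ I p := [isSub for @Lp_val I p].
HB.instance Definition _ I p := [Choice of Lp I p by <:].
HB.instance Definition _ I p := [SubChoice_isSubLmodule of Lp I p by <:].

(* [Rintegral] is the integral itself here, the integrand being integrable    *)
(* by [Lp_prop].                                                              *)
Definition Lpnorm I (p : {posnum R}) (x : Lp I p) : R :=
  (\int[mu]_(t in ([set` I] : set lebR))
     (modulus ((repr (Lp_val x) : Mfun I) t) `^ p%:num)) `^ (p%:num)^-1.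

(* For p < 1, [Lpnorm] violates the triangle inequality, but its balls are    *)
(* those of the metric [Lpnorm (y - x) `^ p].                                 *)
Definition Lp_open I (p : {posnum R}) : set_system (Lp I p) :=
  [set U | forall x, U x -> exists2 e : R, 0 < e &
    [set y | Lpnorm (y - x) < e] `<=` U].

Lemma Lp_openT I p : @Lp_open I p setT.
Proof. by move=> x _; exists 1. Qed.

Lemma Lp_openI I p : setI_closed (@Lp_open I p).
Proof.
move=> U V oU oV x [/oU[e e0 eU] /oV[d d0 dV]].
exists (Num.min e d); first by rewrite lt_min e0.
by move=> y /=; rewrite lt_min => /andP[/eU ? /dV].
Qed.

Lemma Lp_open_bigU I p (J : Type) (F : J -> set (Lp I p)) :
  (forall j, Lp_open (F j)) -> Lp_open (\bigcup_j F j).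
Proof.
move=> oF x [j _ /oF[e e0 eF]]; exists e => // y /eF; exists j => //.
Qed.

HB.instance Definition _ I p := isOpenTopological.Build (Lp I p)
  (@Lp_openT I p) (@Lp_openI I p) (@Lp_open_bigU I p).

End Lebesgue.

Arguments Lp_set {R} k I p.
Arguments Lp {R} k I p.

(* Main.v *)
Require Import Defs.
From HB Require Import structures.
From mathcomp Require Import all_boot all_order all_algebra.
From mathcomp Require Import complex.
From mathcomp Require Import all_classical all_reals all_analysis.
From mathcomp Require Import measurable_realfun.
From mathcomp Require Import ring lra zify.

Set Implicit Arguments.
Unset Strict Implicit.
Unset Printing Implicit Defensive.

Import Order.TTheory GRing.Theory Num.Theory.
Import numFieldNormedType.Exports.

Local Open Scope classical_set_scope.
Local Open Scope card_scope.
Local Open Scope quotient_scope.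
Local Open Scope ring_scope.

(** The members of [L_p] lying in no [L_q] with [q > p] are those outside the
    subspace [V] of functions that are [q]-integrable for some [q > p], so every
    statement of spaceability is about subspaces meeting [V] only in [0].

    The unit interval contains disjoint pieces whose lengths decay like
    [2 ^ -(n ^ 2)].  A single function [spike] takes on the [n]-th piece a
    constant value contributing [2 ^ -n] to the integral of its [p]-th power
    ([p_integrable_piecewise]); for [q > p] the contributions to the integral of
    the [q]-th power are unbounded, hence [spike] is not [q]-integrable on any
    union of infinitely many pieces ([not_higher_integrable]).  The pieces are
    grouped into infinitely many disjoint zones, each of them cut into
    infinitely many blocks, each block being such an infinite union.  Inside one
    zone, the multiples [a_j * spike] on the [j]-th block form a closed space
    ([block_multiples]) which meets [V] only in [0], and the choices
    [a_j = s ^ j] with [0 < s < 1] give continuum many members that are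
    independent modulo [V] ([indep_geom], by a Vandermonde argument).  This
    already yields [alpha]-lineability for every [alpha] up to the continuum.

    Suppose [alpha] is finite, and let [F] be a subspace of dimension [alpha]
    meeting [V] only in [0].  There is a zone whose complement [S] still sees
    [F]: no nonzero member of [F] is [q]-integrable on [S] for some [q > p].
    Otherwise each zone would provide a nonzero [f_i] in [F] that is badly
    integrable on the [i]-th zone only, and infinitely many such functions are
    independent ([finite_dim_escape]).  The sum of [F] and of the block multiples
    in that zone then meets [V] only in [0].  It is closed, because adding one
    vector to a closed subspace keeps it closed ([gauge_closed_add_line]), and
    its dimension is that of the continuum: it contains the independent family
    above, and its elements are coded by sequences of scalars, which are no more
    numerous than the reals ([has_dim_continuum]).

    Suppose [alpha] is infinite.  Choose a nonzero [v] in [V] and distinct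
    members [u_n] of the independent family.  Adding [r_n * v] to [u_n], with
    [r_n] growing fast, preserves independence modulo [V] ([indep_modD]), so the
    span still meets [V] only in [0]; but [(u_n + r_n * v) / r_n] converges to
    [v], so no closed subspace containing this span avoids [V]
    ([not_spaceable_infinite]). *)

(** * Subspaces, spans and independence modulo a subspace *)

Section LinearAlgebra.
Context {K : numFieldType} {E : lmodType K}.
Implicit Types (F V B : set E) (s t : seq E) (c : E -> K).

Lemma vector_subspaceP F : vector_subspace F <->
  F 0 /\ forall a x y, F x -> F y -> F (a *: x + y).
Proof.
split=> -[F0 FD]; split.
- exact: set_mem.
- by move=> a x y Fx Fy; apply: set_mem; apply: FD; exact: mem_set.
- exact: mem_set.
- by move=> a x y /set_mem Fx /set_mem Fy; apply: mem_set; exact: FD.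
Qed.

Section SubspaceOps.
Variables (F : set E) (sF : vector_subspace F).

Lemma subspace0 : F 0.
Proof. by have [] := (vector_subspaceP F).1 sF. Qed.

Lemma subspaceZD a x y : F x -> F y -> F (a *: x + y).
Proof. have [_] := (vector_subspaceP F).1 sF; exact. Qed.

Lemma subspaceZ a x : F x -> F (a *: x).
Proof.
move=> Fx; rewrite -[X in F X]addr0; apply: subspaceZD => //.
exact: subspace0.
Qed.

Lemma subspaceD x y : F x -> F y -> F (x + y).
Proof. by move=> Fx Fy; rewrite -[x]scale1r; exact: subspaceZD. Qed.

Lemma subspaceB x y : F x -> F y -> F (x - y).
Proof. by move=> Fx Fy; rewrite addrC -scaleN1r; exact: subspaceZD. Qed.

Lemma subspace_sum (I : eqType) (r : seq I) (P : pred I) (f : I -> E) :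
  (forall i, i \in r -> P i -> F (f i)) -> F (\sum_(i <- r | P i) f i).
Proof.
move=> Ff; rewrite big_seq_cond.
apply: (big_ind F); [exact: subspace0|exact: subspaceD|].
by move=> i /andP[]; exact: Ff.
Qed.

Lemma subspaceZV a x : a != 0 -> F (a *: x) -> F x.
Proof.
by move=> a0 Fax; rewrite -[x]scale1r -(mulVf a0) -scalerA; exact: subspaceZ.
Qed.

End SubspaceOps.

Lemma subspaceI F V : vector_subspace F -> vector_subspace V ->
  vector_subspace (F `&` V).
Proof.
move=> sF sV; apply/vector_subspaceP; split.
  by split; exact: subspace0.
by move=> a x y [? ?] [? ?]; split; exact: subspaceZD.
Qed.

Lemma subspace_bigcap (J : Type) (F : J -> set E) :
  (forall j, vector_subspace (F j)) -> vector_subspace (\bigcap_j F j).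
Proof.
move=> sF; apply/vector_subspaceP; split.
  by move=> j _; exact: subspace0.
by move=> a x y Fx Fy j _; apply: subspaceZD; [|exact: Fx|exact: Fy].
Qed.

Definition add_line F (v : E) : set E := [set x | exists a : K, F (x - a *: v)].

Lemma subspace_add_line F v : vector_subspace F -> vector_subspace (add_line F v).
Proof.
move=> sF; apply/vector_subspaceP; split.
  by exists 0; rewrite scale0r subrr; exact: subspace0.
move=> a x y [b Fx] [c Fy]; exists (a * b + c).
rewrite (_ : _ - _ = a *: (x - b *: v) + (y - c *: v)); first exact: subspaceZD.
by rewrite scalerDl scalerBr scalerA opprD addrACA.
Qed.

Lemma sub_add_line F v : F `<=` add_line F v.
Proof. by move=> x Fx; exists 0; rewrite scale0r subr0. Qed.

Lemma mem_add_line F v : vector_subspace F -> add_line F v v.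
Proof. by move=> sF; exists 1; rewrite scale1r subrr; exact: subspace0. Qed.

(** Spans are defined with sequences that may have repetitions; collecting equal
    entries lets two combinations be compared over one duplicate-free sequence. *)
Lemma sum_subseq_count s t c : uniq t -> {subset s <= t} ->
  \sum_(x <- s) c x *: x = \sum_(x <- t) (c x *+ count_mem x s) *: x.
Proof.
move=> ut; elim: s => [|y s IH] st.
  by rewrite big_nil big1_seq// => x _; rewrite mulr0n scale0r.
rewrite big_cons IH; last by move=> x xs; apply: st; rewrite inE xs orbT.
have yt : y \in t by apply: st; rewrite mem_head.
rewrite [LHS](_ : _ = \sum_(x <- t)
    ((c x *+ (y == x)) *: x + (c x *+ count_mem x s) *: x)).
  by apply: eq_bigr => x _; rewrite -scalerDl -mulrnDr.
rewrite big_split/=; congr (_ + _).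
rewrite (bigD1_seq y)//= eqxx mulr1n big1 ?addr0// => x /negPf xy.
by rewrite eq_sym xy mulr0n scale0r.
Qed.

Lemma lin_span_uniq B y : lin_span B y ->
  exists s c, [/\ uniq s, [set` s] `<=` B & y = \sum_(x <- s) c x *: x].
Proof.
move=> [s [c [sB ->]]]; exists (undup s), (fun x => c x *+ count_mem x s).
split; first exact: undup_uniq.
  by move=> x /=; rewrite mem_undup => xs; exact: sB.
apply: sum_subseq_count; first exact: undup_uniq.
by move=> x; rewrite mem_undup.
Qed.

Lemma lin_span_seq s y : uniq s -> lin_span [set` s] y ->
  exists c, y = \sum_(x <- s) c x *: x.
Proof.
move=> us [t [c [ts ->]]]; exists (fun x => c x *+ count_mem x t).
by apply: sum_subseq_count => // x /ts.
Qed.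

Lemma subspace_lin_span B : vector_subspace (lin_span B).
Proof.
apply/vector_subspaceP; split.
  by exists [::], (fun=> 0); split => //; rewrite big_nil.
move=> a x y [s [c [sB ->]]] [t [d [tB ->]]].
exists (undup (s ++ t)), (fun x => a * (c x *+ count_mem x s) + d x *+ count_mem x t).
split.
  by move=> z /=; rewrite mem_undup mem_cat => /orP[/sB|/tB].
have us := undup_uniq (s ++ t).
rewrite (sum_subseq_count _ us); last by move=> z zs; rewrite mem_undup mem_cat zs.
rewrite (sum_subseq_count d us); last by move=> z zs; rewrite mem_undup mem_cat zs orbT.
rewrite scaler_sumr -big_split; apply: eq_bigr => z _ /=.
by rewrite scalerA scalerDl.
Qed.

Lemma sub_lin_span B : B `<=` lin_span B.
Proof.
move=> x Bx; exists [:: x], (fun=> 1); split; last by rewrite big_seq1 scale1r.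
by move=> y /=; rewrite inE => /eqP ->.
Qed.

Lemma lin_span_sub B F : vector_subspace F -> B `<=` F -> lin_span B `<=` F.
Proof.
move=> sF BF _ [s [c [sB ->]]]; apply: subspace_sum => // x xs _.
by apply: subspaceZ => //; apply: BF; exact: sB.
Qed.

(** Independence of the images in the quotient by [V], phrased without the
    quotient.  It contains injectivity of the family, it makes the span meet [V]
    only in [0], and it survives the addition of elements of [V]. *)
Definition indep_mod (I : eqType) V (u : I -> E) (D : set I) :=
  forall (s : seq I) (c : I -> K), uniq s -> [set` s] `<=` D ->
  V (\sum_(i <- s) c i *: u i) -> forall i, i \in s -> c i = 0.

Lemma indep_mod_sub (I : eqType) V (u : I -> E) (D D' : set I) :
  D' `<=` D -> indep_mod V u D -> indep_mod V u D'.
Proof. by move=> D'D iu s c us sD'; apply: iu => //; exact: subset_trans D'D. Qed.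

Lemma indep_modD (I : eqType) V (u v : I -> E) (D : set I) :
  vector_subspace V -> (forall i, D i -> V (v i)) ->
  indep_mod V u D -> indep_mod V (fun i => u i + v i) D.
Proof.
move=> sV Vv iu s c us sD Vs; apply: (iu s c us sD).
rewrite (_ : \sum_(i <- s) _ =
  \sum_(i <- s) c i *: (u i + v i) - \sum_(i <- s) c i *: v i); last first.
  by rewrite -sumrB; apply: eq_bigr => i _; rewrite scalerDr addrK.
apply: subspaceB => //; apply: subspace_sum => // i /sD Di _.
by apply: subspaceZ => //; exact: Vv.
Qed.

Section IndepMod.
Variables (I : choiceType) (V : set E) (u : I -> E) (D : set I).
Hypotheses (sV : vector_subspace V) (iu : indep_mod V u D).

Lemma indep_mod_inj : {in D &, injective u}.
Proof.
move=> i j /set_mem Di /set_mem Dj uij; apply: contrapT => /eqP ij.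
suff : (1 : K) = 0 by apply/eqP; exact: oner_neq0.
pose c x : K := if x == i then 1 else -1.
have <- : c i = 1 by rewrite /c eqxx.
apply: (iu (s := [:: i; j])); rewrite /= ?inE ?ij ?eqxx//.
  by move=> x /=; rewrite !inE => /orP[] /eqP ->.
rewrite big_cons big_seq1 /c eqxx eq_sym (negPf ij) uij scale1r scaleN1r subrr.
exact: subspace0.
Qed.

Lemma lift_image_seq (s : seq E) : [set` s] `<=` u @` D ->
  exists2 t : seq I, [set` t] `<=` D & s = map u t.
Proof.
elim: s => [|x s IH] sD; first by exists [::].
have [t tD ->] : exists2 t : seq I, [set` t] `<=` D & s = map u t.
  by apply: IH => y /= ys; apply: sD; rewrite /= inE ys orbT.
have [i Di <-] := sD x (mem_head _ _).
by exists (i :: t) => // j /=; rewrite inE => /orP[/eqP ->|/tD].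
Qed.

Lemma lin_span_image y : lin_span (u @` D) y ->
  exists (s : seq I) (c : I -> K),
    [/\ uniq s, [set` s] `<=` D & y = \sum_(i <- s) c i *: u i].
Proof.
move=> /lin_span_uniq[s [c [us /lift_image_seq[t tD st] ->]]].
exists t, (c \o u); split => //; first by apply: (@map_uniq _ _ u); rewrite -st.
by rewrite st big_map.
Qed.

Lemma lin_indep_image : lin_indep (u @` D).
Proof.
move=> s c us /lift_image_seq[t tD st] s0 x.
rewrite st => /mapP[i it ->]; apply: (iu (s := t) (c := c \o u)) => //.
  by apply: (@map_uniq _ _ u); rewrite -st.
by move: s0; rewrite st big_map => ->; exact: subspace0.
Qed.

Lemma has_dim_indep_mod : has_dim (lin_span (u @` D)) D.
Proof.
exists (u @` D); split; first by split => //; exact: lin_indep_image.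
exact: inj_card_eq indep_mod_inj.
Qed.

Lemma span_indep_mod_cap y : lin_span (u @` D) y -> V y -> y = 0.
Proof.
move=> /lin_span_image[s [c [us sD ->]]] Vs.
by apply: big1_seq => i /= si; rewrite (iu us sD Vs si) scale0r.
Qed.

End IndepMod.

Lemma lin_indepU1 B y : lin_indep B -> ~ lin_span B y -> lin_indep (B `|` [set y]).
Proof.
move=> iB yB s c us sB s0.
have remB : [set` rem y s] `<=` B.
  move=> x /=; rewrite mem_rem_uniq// inE => /andP[xy xs].
  by have [|/eqP] := sB x xs; [|rewrite (negPf xy)].
have [ys|ys] := boolP (y \in s); last first.
  by apply: iB => // x xs; have [//|xy] := sB x xs; rewrite -xy /= xs in ys.
move: s0; rewrite (big_rem y ys)/= => s0.
have cy0 : c y = 0.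
  apply: contrapT => /eqP cy0; apply: yB.
  exists (rem y s), (fun x => - ((c y)^-1 * c x)); split => //.
  rewrite -[LHS]scale1r -(mulVf cy0) -scalerA.
  move/eqP: s0; rewrite addr_eq0 => /eqP ->.
  rewrite scalerN scaler_sumr -sumrN; apply: eq_bigr => x _.
  by rewrite scaleNr scalerA.
rewrite cy0 scale0r add0r in s0.
move=> x xs; have [->//|xy] := eqVneq x y.
by apply: (iB (rem y s)) => //; [exact: rem_uniq|rewrite mem_rem_uniq// inE xy].
Qed.

(** By Zorn's lemma: a maximal independent set containing [B0] spans [F], since a
    vector outside its span could be added ([lin_indepU1]). *)
Lemma hamel_basis_extend F B0 : vector_subspace F -> lin_indep B0 -> B0 `<=` F ->
  exists B, hamel_basis F B /\ B0 `<=` B.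
Proof.
move=> sF iB0 B0F.
(* [B] alone need not contain [B0]: the empty chain has an empty union. *)
pose P := [set B | lin_indep (B `|` B0) /\ B `<=` F].
have [|A [[iA AF] maxA]] := @Zorn_bigcup _ P.
  move=> C CP Ctot; split; last by apply: bigcup_sub => X /CP[].
  move=> s c us sC.
  have [X PX sX] : exists2 X, P X & [set` s] `<=` X `|` B0.
    suff [X CX sX] : exists2 X, C X \/ X = set0 & [set` s] `<=` X `|` B0.
      exists X => //; case: CX => [/CP//|->]; split => //.
      by rewrite set0U.
    elim: s {us} sC => [|x s IH] sC; first by exists set0 => //; right.
    have [X CX sX] : exists2 X, C X \/ X = set0 & [set` s] `<=` X `|` B0.
      by apply: IH => z zs; apply: sC; rewrite /= inE; apply/orP; right.
    have consX Y : X `<=` Y -> (Y `|` B0) x -> [set` x :: s] `<=` Y `|` B0.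
      move=> XY Yx z /=; rewrite inE => /orP[/eqP -> //|/sX[/XY ?|?]]; by [left|right].
    have [[Y CY Yx]|B0x] := sC x (mem_head _ _); last first.
      by exists X => //; apply: consX => //; right.
    case: CX => [CX|X0]; last first.
      exists Y; first by left.
      by apply: consX; [rewrite X0|left].
    have [XY|YX] := Ctot _ _ CX CY.
      by exists Y; [left|apply: consX => //; left].
    by exists X; [left|apply: consX => //; left; exact: YX].
  by move=> s0; apply: (PX.1).
exists (A `|` B0); split; last exact: subsetUr.
split => //; apply/seteqP; split; first by apply: lin_span_sub => // x [/AF|/B0F].
move=> y Fy; apply: contrapT => yA; apply: (maxA (A `|` [set y])).
  split; first by move=> x Ax; left.
  by move=> /(_ y (or_intror erefl)) Ay; apply: yA; apply: sub_lin_span; left.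
split; last by move=> x [/AF//|->].
by rewrite setUAC; exact: lin_indepU1.
Qed.

(** Here [W i] stands for good behaviour on the [i]-th of infinitely many disjoint
    regions and [V' i] for good behaviour off that region.  If every [V' i] met the
    span in some [f i != 0], one more of them than the length of [s] would satisfy
    a nontrivial linear relation; but when [f i] occurs in it, all the other terms
    lie in [W i], hence so does [f i], which is then good everywhere. *)
Lemma finite_dim_escape (s : seq E) V (W V' : nat -> set E) :
  uniq s -> (forall i, vector_subspace (W i)) ->
  (forall i x, V' i x -> W i x -> V x) ->
  (forall i j, i != j -> V' j `<=` W i) ->
  (forall x, lin_span [set` s] x -> V x -> x = 0) ->
  exists i, forall x, lin_span [set` s] x -> V' i x -> x = 0.
Proof.
move=> us sW WV V'W FV; apply: contrapT => noi.
have /choice[f fP] : forall i, exists x,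
    [/\ lin_span [set` s] x, V' i x & x != 0].
  move=> i; apply: contrapT => nox; apply: noi; exists i => x Fx V'x.
  by apply: contrapT => /eqP x0; apply: nox; exists x.
have /choice[c cP] : forall i, exists c, f i = \sum_(x <- s) c x *: x.
  by move=> i; apply: lin_span_seq => //; have [] := fP i.
pose M := \matrix_(i < (size s).+1, k < size s) c i (tnth (in_tuple s) k).
have kM : kermx M != 0.
  by rewrite kermx_eq0 /row_free ltn_eqF// ltnS rank_leq_col.
have /rowV0Pn[v /sub_kermxP vM v0] := kM.
have fM (i : 'I_(size s).+1) : f i = \sum_(k < size s) M i k *: tnth (in_tuple s) k.
  by rewrite cP (big_tnth _ _ s); apply: eq_bigr => k _; rewrite mxE.
have vf0 : \sum_(i < (size s).+1) v 0 i *: f i = 0.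
  under eq_bigr => i _ do rewrite fM scaler_sumr.
  rewrite exchange_big/= big1// => k _.
  under eq_bigr => i _ do rewrite scalerA.
  rewrite -scaler_suml (_ : \sum_i _ = (v *m M) 0 k); last by rewrite mxE.
  by rewrite vM mxE scale0r.
have [i vi0] : exists i, v 0 i != 0.
  apply: contrapT => nov; move/eqP: v0; apply; apply/rowP => i; rewrite mxE.
  by apply: contrapT => /eqP vi; apply: nov; exists i.
have [Ffi V'fi /eqP] := fP i; apply; apply: FV => //; apply: (WV i) => //.
apply: (subspaceZV (sW i) vi0).
move: vf0; rewrite (bigD1 i)//= => /eqP; rewrite addr_eq0 => /eqP ->.
rewrite -scaleN1r; apply: subspaceZ => //.
apply: subspace_sum => // j _ ji; apply: subspaceZ => //.
by have [_ ? _] := fP j; apply: (V'W i j) => //; rewrite eq_sym.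
Qed.

End LinearAlgebra.

(** * Dimension of the continuum *)

Lemma inj_card_leT (T U : Type) (f : T -> U) :
  injective f -> [set: T] #<= [set: U].
Proof.
move=> fi; apply: card_le_trans (card_leT (range f)).
have /card_esym := @inj_card_eq _ _ [set: T] f (in2W fi).
by rewrite card_eq_le => /andP[].
Qed.

Section Bits.
Variable R : realType.

Let S (b : nat -> bool) n : R := \sum_(k < n) (b k)%:R * 3^-1 ^+ k.

Let S_incr b n m : (n <= m)%N -> S b n <= S b m.
Proof.
move=> nm; rewrite -(subnKC nm); elim: (m - n)%N => [|d IH]; first by rewrite addn0.
rewrite addnS; apply: le_trans IH _; rewrite /S big_ord_recr lerDl.
by rewrite mulr_ge0// exprn_ge0// invr_ge0.
Qed.

Let S_tail b m d : S b (m.+1 + d) <= S b m.+1 + 3^-1 ^+ m / 2 - 3^-1 ^+ (m + d) / 2.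
Proof.
elim: d => [|d IH]; first by rewrite !addn0 addrK.
rewrite addnS {1}/S big_ord_recr /= -/(S b (m.+1 + d)).
have b1 : (b (m.+1 + d)%N)%:R * 3^-1 ^+ (m.+1 + d) <= 3^-1 ^+ (m.+1 + d) :> R.
  by case: (b _); rewrite ?mul1r// mul0r exprn_ge0// invr_ge0.
apply: le_trans (lerD IH b1) _; rewrite addnS addSn exprS.
by set x := _ ^+ (m + d); lra.
Qed.

Let S_le b m n : S b n <= S b m.+1 + 3^-1 ^+ m / 2.
Proof.
have h (k : nat) : 0 <= 3^-1 ^+ k :> R by rewrite exprn_ge0// invr_ge0.
have [nm|/ltnW mn] := leqP n m.+1.
  by apply: le_trans (S_incr b nm) _; rewrite lerDl divr_ge0.
rewrite -(subnKC mn); apply: le_trans (S_tail _ _ _) _.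
by rewrite lerBlDr lerDl divr_ge0.
Qed.

(* Reading bits in base 3 is injective: the digits after a difference cannot
   compensate it ([S_le]). *)
Let real_of_bits (b : nat -> bool) : R := sup (range (S b)).

Let real_of_bits_lt (b b' : nat -> bool) m :
  (forall k, (k < m)%N -> b k = b' k) -> b m -> ~~ b' m ->
  real_of_bits b' < real_of_bits b.
Proof.
move=> bb' bm b'm.
have Sb : S b m.+1 <= real_of_bits b.
  apply: ub_le_sup; last by exists m.+1.
  by exists (S b 1 + 3^-1 ^+ 0 / 2) => _ [n _ <-].
apply: lt_le_trans Sb.
have Sb' : real_of_bits b' <= S b' m.+1 + 3^-1 ^+ m / 2.
  by apply: ge_sup => [|_ [n _ <-]//]; exists (S b' 0), 0%N.
apply: le_lt_trans Sb' _; rewrite /S !big_ord_recr/= bm (negPf b'm) mul0r addr0 mul1r.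
rewrite (eq_bigr (fun k : 'I_m => (b k)%:R * 3^-1 ^+ k)); last first.
  by move=> k _; rewrite bb'.
rewrite ltrD2l ltr_pdivrMr// ltr_pMr; first by rewrite (ltr_nat _ 1 2).
by rewrite exprn_gt0// invr_gt0.
Qed.

Lemma bits_le_real : [set: nat -> bool] #<= [set: R].
Proof.
apply: (@inj_card_leT _ _ real_of_bits) => b b' bb'; apply: contrapT => nbb'.
have exk : exists k, b k != b' k.
  apply: contrapT => nok; apply: nbb'; apply/funext => k.
  by apply: contrapT => /eqP kk; apply: nok; exists k.
pose m := ex_minn exk.
have [bm lm] : b m != b' m /\ forall k, (k < m)%N -> b k = b' k.
  rewrite /m; case: ex_minnP => n bn ln; split => // k kn.
  by apply: contrapT => /eqP /ln; rewrite leqNgt kn.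
have := ltxx (real_of_bits b).
case bmE: (b m) bm; case b'mE : (b' m) => // _.
  by rewrite {1}bb' (@real_of_bits_lt _ _ m)// b'mE.
by rewrite {2}bb' (@real_of_bits_lt _ _ m)// ?bmE// => k /lm.
Qed.

(** The Dedekind cut of [x], over the enumeration of the rationals. *)
Definition bits_of_real (x : R) : nat -> bool :=
  fun n => if unpickle n is Some q then ratr q < x else false.

Lemma bits_of_real_inj : injective bits_of_real.
Proof.
suff lt (x y : R) : x < y -> bits_of_real x <> bits_of_real y.
  by move=> x y xy; have [/lt|/lt/(_ (esym xy))|//] := ltgtP x y.
move=> xy e.
have [q] := rat_in_itvoo xy; rewrite in_itv/= => /andP[xq qy].
have := congr1 (fun b => b (pickle q)) e; rewrite /bits_of_real pickleK qy.
by rewrite ltNge (ltW xq).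
Qed.

End Bits.

Section Continuum.
Variables (R : realType) (k : scalar_kind).
Notation K := (scalar_field R k).

Lemma scalar_bits : exists f : K -> nat -> bool, injective f.
Proof.
case: k => /=; first by exists (@bits_of_real R); exact: bits_of_real_inj.
exists (fun z n => if unpickle n is Some (b, i) then
  bits_of_real (if b then complex.Re z else complex.Im z) i else false).
move=> [a b] [c d] e; congr (complex.Complex _ _); apply: bits_of_real_inj;
  apply/funext => i.
  have := congr1 (fun b => b (pickle (true, i))) e.
  by rewrite !pickleK.
have := congr1 (fun b => b (pickle (false, i))) e.
by rewrite !pickleK.
Qed.

Lemma scalar_sequences_le_real : [set: nat -> K] #<= [set: R].
Proof.
apply: card_le_trans (bits_le_real R).
have [f fi] := scalar_bits.
apply: (@inj_card_leT _ _ (fun a n =>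
  if unpickle n is Some (i, j) then f (a i) j else false)) => a b e.
apply/funext => i; apply: fi; apply/funext => j.
by have := congr1 (fun b => b (pickle (i, j))) e; rewrite !pickleK.
Qed.

(** The family [u] bounds the dimension from below, and from above a basis has no
    more elements than [F], whose elements are coded by sequences of scalars. *)
Lemma has_dim_continuum (E : lmodType K) (F : set E) (u : R -> E)
    (psi : E -> nat -> K) :
  vector_subspace F -> indep_mod [set 0] u setT -> range u `<=` F ->
  {in F &, injective psi} -> has_dim F [set: R].
Proof.
move=> sF iu uF psiF.
have s0 : vector_subspace [set 0 : E].
  apply/vector_subspaceP; split => // a x y -> ->.
  by rewrite /= scaler0 addr0.
have [B [hB uB]] := hamel_basis_extend sF (lin_indep_image s0 iu) uF.
exists B; split => //; rewrite card_eq_le; apply/andP; split.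
  have BF : B `<=` F by case: hB => _ <-; exact: sub_lin_span.
  apply: card_le_trans (subset_card_le BF) _.
  apply: card_le_trans scalar_sequences_le_real.
  apply: card_le_trans (card_leT (psi @` F)).
  have /card_esym := inj_card_eq psiF.
  by rewrite card_eq_le => /andP[].
apply: card_le_trans (subset_card_le uB).
have /card_esym := inj_card_eq (indep_mod_inj s0 iu).
by rewrite card_eq_le => /andP[].
Qed.

End Continuum.

(** * Adding one vector to a closed subspace *)

Section Complete.
Variables (R : realType) (k : scalar_kind).
Notation K := (scalar_field R k).

Definition tends_to (c : nat -> K) (l : K) :=
  forall e : R, 0 < e -> exists N, forall n, (N <= n)%N -> modulus (c n - l) < e.

Lemma real_complete (c : nat -> R) :
  (forall e, 0 < e -> exists N, forall n m, (N <= n)%N -> (N <= m)%N ->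
     `|c n - c m| < e) ->
  exists l, forall e, 0 < e -> exists N, forall n, (N <= n)%N -> `|c n - l| < e.
Proof.
move=> cc.
have /cauchy_cvgP/cvg_ex[l cl] : cauchy (c @ \oo).
  apply/cauchy_ballP => e e0.
  have [N cN] := cc _ e0.
  rewrite near_simpl; exists ([set n | (N <= n)%N], [set n | (N <= n)%N]).
    by split; exists N.
  by move=> [n m] [/= Nn Nm]; rewrite /ball/=; exact: cN.
exists l => e e0; move/cvgrPdist_lt : cl => /(_ _ e0)[N _ cN].
by exists N => n Nn; rewrite distrC; exact: cN.
Qed.

Lemma modulusN (x : K) : modulus (- x) = modulus x.
Proof.
by case: k x => /= [x|[a b] /=]; [exact: normrN|rewrite !sqrrN].
Qed.

Lemma modulusB (x y : K) : modulus (x - y) = modulus (y - x).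
Proof. by rewrite -modulusN opprB. Qed.

Lemma scalar_complete (c : nat -> K) :
  (forall e : R, 0 < e -> exists N, forall n m, (N <= n)%N -> (N <= m)%N ->
     modulus (c n - c m) < e) ->
  exists l, tends_to c l.
Proof.
rewrite /tends_to; case: k c => /= c cc; first exact: real_complete.
have sqrt_le (a b : R) : Num.sqrt (a ^+ 2 + b ^+ 2) <= `|a| + `|b|.
  rewrite -[leRHS]ger0_norm ?addr_ge0// -sqrtr_sqr ler_wsqrtr//.
  rewrite -(real_normK (num_real a)) -(real_normK (num_real b)).
  by rewrite [leRHS]sqrrD addrAC lerDl mulrn_wge0 ?mulr_ge0.
have reB (z w : R[i]) : complex.Re z - complex.Re w = complex.Re (z - w).
  by case: z w => [? ?] [? ?].
have imB (z w : R[i]) : complex.Im z - complex.Im w = complex.Im (z - w).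
  by case: z w => [? ?] [? ?].
have ren (z : R[i]) : `|complex.Re z| <= ComplexField.Normc.normc z.
  by case: z => a b /=; rewrite -sqrtr_sqr ler_wsqrtr// lerDl sqr_ge0.
have imn (z : R[i]) : `|complex.Im z| <= ComplexField.Normc.normc z.
  by case: z => a b /=; rewrite -sqrtr_sqr ler_wsqrtr// lerDr sqr_ge0.
have [|a ca] := @real_complete (fun n => complex.Re (c n)).
  move=> e /cc[N cN]; exists N => n m Nn Nm; rewrite reB.
  by apply: le_lt_trans (ren _) _; exact: cN.
have [|b cb] := @real_complete (fun n => complex.Im (c n)).
  move=> e /cc[N cN]; exists N => n m Nn Nm; rewrite imB.
  by apply: le_lt_trans (imn _) _; exact: cN.
exists (complex.Complex a b) => e e0.
have e20 : 0 < e / 2 by rewrite divr_gt0.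
have [N cN] := ca _ e20; have [M cM] := cb _ e20.
exists (maxn N M) => n; rewrite geq_max => /andP[/cN ha /cM hb].
rewrite [ltRHS]splitr; apply: le_lt_trans (ltrD ha hb).
by case: (c n) => x y /=; exact: sqrt_le.
Qed.

End Complete.

(** The hypotheses on [N] are those satisfied by the [p]-th power of a quasi-norm;
    they cover the norms of [L_p] for [p >= 1] and the [p]-norms for [p < 1]
    alike. *)
Section Gauge.
Variables (R : realType) (k : scalar_kind).
Notation K := (scalar_field R k).
Variables (E : lmodType K) (N : E -> R) (p C : R).
Hypotheses (p0 : 0 < p) (C0 : 0 < C) (N0 : forall x, 0 <= N x)
  (NZ : forall a x, N (a *: x) = modulus a `^ p * N x)
  (ND : forall x y, N (x + y) <= C * (N x + N y)).

Definition gauge_closed (M : set E) := forall x,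
  (forall e, 0 < e -> exists2 y, M y & N (y - x) < e) -> M x.

Lemma gauge_closedI (M M' : set E) :
  gauge_closed M -> gauge_closed M' -> gauge_closed (M `&` M').
Proof.
move=> cM cM' x xM; split.
  by apply: cM => e /xM[y [? _] ?]; exists y.
by apply: cM' => e /xM[y [_ ?] ?]; exists y.
Qed.

Lemma gauge_closed_bigcap (J : Type) (M : J -> set E) :
  (forall j, gauge_closed (M j)) -> gauge_closed (\bigcap_j M j).
Proof.
by move=> cM x xM j _; apply: cM => e /xM[y My ?]; exists y => //; exact: My.
Qed.

Let gaugeB x y : N (x - y) = N (y - x).
Proof.
have -> : x - y = (-1 : K) *: (y - x) by rewrite scaleN1r opprB.
by rewrite NZ modulusN -NZ scale1r.
Qed.

(** When [v] is not in [M], its distance [d] to [M] is positive and [m + a *: v]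
    has gauge at least [modulus a `^ p * d]: along a convergent sequence of
    [M + K v] the coefficients of [v] form a Cauchy sequence, and completeness of
    the scalars gives a decomposition of the limit. *)
Lemma gauge_closed_add_line (M : set E) v :
  vector_subspace M -> gauge_closed M -> gauge_closed (add_line M v).
Proof.
move=> sM cM x xM.
have half (t : R) : C * (t / (C * 2) + t / (C * 2)) = t.
  have C2 : C * 2 != 0 by rewrite gt_eqF// mulr_gt0.
  by rewrite -[RHS](divfK C2); set u := t / _; ring.
have [Mv|nMv] := pselect (M v).
  exists 0; rewrite scale0r subr0; apply: cM => e /xM[y [a My] ye].
  exists y => //; rewrite -(subrK (a *: v) y).
  by apply: subspaceD => //; exact: subspaceZ.
have [d d0 dP] : exists2 d, 0 < d & forall m, M m -> d <= N (m - v).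
  apply: contrapT => nd; apply: nMv; apply: cM => e e0.
  apply: contrapT => ne; apply: nd; exists e => // m Mm.
  by rewrite leNgt; apply/negP => me; apply: ne; exists m.
have coef (a : K) m : M m -> modulus a `^ p * d <= N (m + a *: v).
  move=> Mm; have [->|a0] := eqVneq a 0.
    by rewrite modulus0 powR0 ?gt_eqF// mul0r.
  rewrite (_ : m + _ = (- a) *: ((- a^-1) *: m - v)); last first.
    by rewrite scalerBr scalerA mulrNN divff// scale1r scaleNr opprK.
  rewrite NZ modulusN.
  by rewrite ler_wpM2l ?powR_ge0// dP//; exact: subspaceZ.
have /choice[y yP] : forall n : nat, exists y, add_line M v y /\ N (y - x) < n.+1%:R^-1.
  move=> n; have n0 : 0 < n.+1%:R^-1 :> R by rewrite invr_gt0.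
  by have [y ? ?] := xM _ n0; exists y.
have /choice[a aP] : forall n, exists a : K, M (y n - a *: v).
  by move=> n; have [[a ?] _] := yP n; exists a.
have yx e : 0 < e -> exists N0, forall n, (N0 <= n)%N -> N (y n - x) < e.
  move=> e0; exists (Num.truncn e^-1) => n tn; have [_ /lt_trans] := yP n; apply.
  rewrite invf_plt// ?posrE//; apply: lt_le_trans (truncnS_gt _) _.
  by rewrite ler_nat ltnS.
have [e|l al] := @scalar_complete R k a.
  move=> e0.
  have e1 : 0 < e `^ p * d / (C * 2) by rewrite divr_gt0 ?mulr_gt0 ?powR_gt0.
  have [N1 yN] := yx _ e1; exists N1 => n m /yN yn /yN ym.
  rewrite ltNge; apply/negP => eanm.
  have : e `^ p * d <= N (y n - y m).
    rewrite -[y n - y m](subrK ((a n - a m) *: v)).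
    apply: le_trans (coef _ _ _).
      rewrite ler_wpM2r ?(ltW d0)// ge0_ler_powR ?(ltW p0)// ?nnegrE ?modulus_ge0//.
      exact: ltW.
    rewrite (_ : _ - _ = (y n - a n *: v) - (y m - a m *: v)).
      by apply: subspaceB => //; exact: aP.
    rewrite scalerBl !opprB addrACA [RHS]addrACA.
    by congr (_ + _); rewrite addrC.
  apply/negP; rewrite -ltNge -(subrK x (y n)) -addrA.
  apply: le_lt_trans (ND _ _) _; rewrite [N (x - _)]gaugeB.
  apply: lt_le_trans (_ : C * (e `^ p * d / (C * 2) + e `^ p * d / (C * 2)) <= _).
    by rewrite ltr_pM2l// ltrD.
  by rewrite half.
exists l; apply: cM => e e0.
have c20 : 0 < e / (C * 2) by rewrite divr_gt0 ?mulr_gt0.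
have [N1 yN] := yx _ c20.
pose r := (e / (C * 2) / (N v + 1)) `^ p^-1.
have Nv0 : 0 < N v + 1 by rewrite ltr_wpDl.
have r0 : 0 < r by apply: powR_gt0; exact: divr_gt0.
have [N2 aN] := al _ r0.
set n := maxn N1 N2.
exists (y n - a n *: v) => //.
rewrite (_ : _ - (x - _) = (y n - x) + (l - a n) *: v); last first.
 rewrite opprB scalerBl addrACA [RHS]addrACA; congr (_ + _).
  by rewrite addrC.
apply: le_lt_trans (ND _ _) _.
have h1 : N (y n - x) < e / (C * 2) by apply: yN; exact: leq_maxl.
have h2 : N ((l - a n) *: v) <= e / (C * 2).
  rewrite NZ; apply: (@le_trans _ _ (r `^ p * (N v + 1))).
    apply: ler_pM; rewrite ?powR_ge0// ?lerDl//.
    rewrite ge0_ler_powR ?(ltW p0)// ?nnegrE ?modulus_ge0 ?(ltW r0)//.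
    by rewrite modulusB ltW// aN// leq_maxr.
  rewrite -powRrM mulVf ?gt_eqF// powRr1 ?divr_ge0 ?mulr_ge0
    ?(ltW e0) ?(ltW C0) ?(ltW Nv0)//.
  by rewrite divfK ?gt_eqF.
by rewrite -[ltRHS]half ltr_pM2l// ltr_leD.
Qed.

End Gauge.

(** * Elements of L_p through representatives *)

Section LpElements.
Variables (R : realType) (k : scalar_kind) (I : interval R) (p : {posnum R}).
Notation K := (scalar_field R k).
Notation mu := (@completed_lebesgue_measure R).
Notation lebR := (caratheodory_type (@wlength R idfun)^*%mu).
Local Notation E := (Lp k I p).
Implicit Types (x y : E) (S : set lebR) (q : R) (f g : R -> K).

Definition rep x : R -> K := repr (Lp_val x) : Mfun k I.

Definition eq_on S f g := {ae mu, forall t : lebR, S t -> f t = g t}.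

Lemma eq_on_sym S f g : eq_on S f g -> eq_on S g f.
Proof. by apply: filterS => t /[apply]. Qed.

Lemma eq_on_trans S f g h : eq_on S f g -> eq_on S g h -> eq_on S f h.
Proof. by apply: filterS2 => t fg gh St; rewrite fg// gh. Qed.

Lemma eq_on_sub S S' f g : S' `<=` S -> eq_on S f g -> eq_on S' f g.
Proof. by move=> S'S; apply: filterS => t fg /S'S /fg. Qed.

Lemma rep_eq (x : E) (f : Mfun k I) :
  Lp_val x = \pi_(L0 k I) f -> eq_on [set` I] (rep x) f.
Proof.
rewrite -[Lp_val x]reprK => /L0_eqP /set_mem; apply: filterS => t /[apply] h.
by apply/eqP; rewrite -subr_eq0; apply/eqP.
Qed.

Lemma rep_ZD a x y :
  eq_on [set` I] (rep (a *: x + y)) (fun t => a * rep x t + rep y t).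
Proof.
apply: (rep_eq (f := a *: (repr (Lp_val x)) + (repr (Lp_val y)) : Mfun k I)).
rewrite L0_addE reprK; congr (_ + _).
Qed.

Lemma rep0 : eq_on [set` I] (rep 0) (fun=> 0).
Proof. by apply: (rep_eq (f := 0)); rewrite L0_zeroE. Qed.

Lemma repZ a x : eq_on [set` I] (rep (a *: x)) (fun t => a * rep x t).
Proof.
have := rep_ZD a x 0; rewrite addr0; apply: filterS2 rep0 => t + + It.
by move=> /(_ It) -> /(_ It) ->; rewrite addr0.
Qed.

Lemma rep_inj x y : eq_on [set` I] (rep x) (rep y) -> x = y.
Proof.
move=> xy; apply/val_inj; rewrite /= -[LHS]reprK -[RHS]reprK; apply/L0_eqP.
apply/mem_set; move: xy; apply: filterS => t /[apply] h.
by change (rep x t - rep y t = 0); rewrite h subrr.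
Qed.

Lemma Lp_of_fun f : lebesgue_measurable [set` I] f -> p_integrable I p%:num f ->
  exists x, eq_on [set` I] (rep x) f.
Proof.
move=> mf fi; pose F : Mfun k I := MkMfun (mem_set mf).
have xP : \pi_(L0 k I) F \in Lp_pred p.
  apply/mem_set; apply: (@p_integrable_ae _ _ _ _ F) => //.
  by apply/L0_eqP; rewrite reprK.
by exists (MkLp xP); exact: (rep_eq (f := F)).
Qed.

Lemma measurable_rep q x :
  measurable_fun ([set` I] : set lebR) (fun t : lebR => (modulus (rep x t) `^ q)%:E).
Proof. exact: measurable_modulus_powR. Qed.

Let mI : measurable ([set` I] : set lebR).
Proof. by apply: measurable_lebR; exact: measurable_itv. Qed.

Definition energy S q x : \bar R := (\int[mu]_(t in S) (modulus (rep x t) `^ q)%:E)%E.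

Section On.
Variable S : set lebR.
Hypotheses (mS : measurable S) (SI : S `<=` [set` I]).

Lemma measurable_rep_on q x :
  measurable_fun S (fun t : lebR => (modulus (rep x t) `^ q)%:E).
Proof. by apply: measurable_funS (measurable_rep q x). Qed.

Let rep_ge0 q x (t : lebR) : S t -> (0 <= (modulus (rep x t) `^ q)%:E)%E.
Proof. by rewrite lee_fin powR_ge0. Qed.

Lemma energy_ge0 q x : (0 <= energy S q x)%E.
Proof. by apply: integral_ge0 => t _; rewrite lee_fin powR_ge0. Qed.

Lemma energy_eq q x (f : R -> K) : eq_on S (rep x) f ->
  measurable_fun S (fun t : lebR => (modulus (f t) `^ q)%:E) ->
  energy S q x = (\int[mu]_(t in S) (modulus (f t) `^ q)%:E)%E.
Proof.
move=> xf mf.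
apply: (ge0_ae_eq_integral mS (measurable_rep_on q x) mf (rep_ge0 q x)).
  by move=> t _; rewrite lee_fin powR_ge0.
by move: xf; apply: filterS => t /[apply] ->.
Qed.

Lemma energy_le q x y (c : R) : 0 <= c ->
  {ae mu, forall t : lebR,
    S t -> modulus (rep x t) `^ q <= c * modulus (rep y t) `^ q} ->
  (energy S q x <= c%:E * energy S q y)%E.
Proof.
move=> c0 xy.
rewrite /energy -(ge0_integralZl _ mS (measurable_rep_on q y) (rep_ge0 q y))//.
apply: (ae_ge0_le_integral mS (rep_ge0 q x) (measurable_rep_on q x)).
- by move=> t St; apply: mule_ge0; rewrite ?lee_fin//; exact: rep_ge0.
- by apply: measurable_funeM; exact: measurable_rep_on.
- by move: xy; apply: filterS => t /[apply]; rewrite -EFinM lee_fin.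
Qed.

Lemma powR_modulusD (q : R) (a b : K) : 0 < q ->
  modulus (a + b) `^ q <= 2 `^ q * (modulus a `^ q + modulus b `^ q).
Proof.
move=> q0; have a0 := modulus_ge0 a; have b0 := modulus_ge0 b.
have m0 : 0 <= Num.max (modulus a) (modulus b) by rewrite le_max a0.
apply: (@le_trans _ _ ((2 * Num.max (modulus a) (modulus b)) `^ q)).
  apply: ge0_ler_powR; rewrite ?nnegrE ?modulus_ge0 ?mulr_ge0 ?(ltW q0)//.
  apply: le_trans (modulusD _ _) _.
  by rewrite mulr2n mulrDl mul1r lerD// le_max lexx ?orbT.
rewrite powRM// ler_wpM2l ?powR_ge0//.
by case: (leP (modulus a) (modulus b)) => _; rewrite ?lerDr ?lerDl powR_ge0.
Qed.

Lemma energyD q x y : 0 < q ->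
  (energy S q (x + y)%R <= (2 `^ q)%:E * (energy S q x + energy S q y))%E.
Proof.
have mxy : measurable_fun S (fun t : lebR =>
    (modulus (rep x t) `^ q)%:E + (modulus (rep y t) `^ q)%:E)%E.
  by apply: emeasurable_funD; exact: measurable_rep_on.
move=> q0; rewrite /energy -(ge0_integralD _ mS (rep_ge0 q x) (measurable_rep_on q x)
  (rep_ge0 q y) (measurable_rep_on q y)).
have xy0 (t : lebR) : S t ->
    (0 <= (modulus (rep x t) `^ q)%:E + (modulus (rep y t) `^ q)%:E)%E.
  by move=> St; apply: adde_ge0; exact: rep_ge0.
have c0 : (0 <= (2 `^ q)%:E :> \bar R)%E by rewrite lee_fin powR_ge0.
rewrite -(ge0_integralZl _ mS mxy xy0 c0).
apply: (ae_ge0_le_integral mS (rep_ge0 q _) (measurable_rep_on q _)).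
- by move=> t St; apply: mule_ge0 => //; exact: xy0.
- exact: measurable_funeM.
have := eq_on_sub SI (rep_ZD 1 x y); rewrite scale1r.
apply: filterS => t /[apply] ->.
by rewrite mul1r -EFinD -EFinM lee_fin; exact: powR_modulusD.
Qed.

Lemma energyZ q a x : energy S q (a *: x) = ((modulus a `^ q)%:E * energy S q x)%E.
Proof.
have ax := eq_on_sub SI (repZ a x).
have E1 : (fun t : lebR => (modulus (a * rep x t) `^ q)%:E) =
    (fun t => (modulus a `^ q)%:E * (modulus (rep x t) `^ q)%:E)%E.
  by apply/funext => t; rewrite modulusM powRM ?modulus_ge0.
rewrite (energy_eq ax) E1.
  rewrite (ge0_integralZl _ mS (measurable_rep_on q x) (rep_ge0 q x))//.
  by rewrite lee_fin powR_ge0.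
by apply: measurable_funeM; exact: measurable_rep_on.
Qed.

End On.

Lemma energy_subset S S' q x : measurable S -> measurable S' -> S `<=` S' ->
  S' `<=` [set` I] -> (energy S q x <= energy S' q x)%E.
Proof.
move=> mS mS' SS' S'I.
apply: (ge0_subset_integral _ mS mS' (measurable_rep_on S'I q x) _ SS') => t _.
by rewrite lee_fin powR_ge0.
Qed.

Lemma energy_Lp x : (energy [set` I] p%:num x < +oo)%E.
Proof.
have /set_mem/integrableP[_] := Lp_prop x.
apply: le_lt_trans; rewrite le_eqVlt; apply/orP; left; apply/eqP.
by apply: eq_integral => t _; rewrite gee0_abs// lee_fin powR_ge0.
Qed.

(** The [p]-th power of [Lpnorm]: unlike [Lpnorm], its quasi-triangle inequality
    holds with one formula for all [p]. *)
Definition gauge x : R := fine (energy [set` I] p%:num x).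

Lemma gaugeE x : (gauge x)%:E = energy [set` I] p%:num x.
Proof. by rewrite fineK// ge0_fin_numE ?energy_Lp// energy_ge0. Qed.

Lemma gauge_ge0 x : 0 <= gauge x.
Proof. by rewrite fine_ge0// energy_ge0. Qed.

Lemma gaugeZ a x : gauge (a *: x) = modulus a `^ p%:num * gauge x.
Proof.
have := energyZ mI (@subset_refl _ _) p%:num a x.
by rewrite -(gaugeE x) -(gaugeE (a *: x)) -EFinM => aE; exact: EFin_inj.
Qed.

Lemma gaugeD x y : gauge (x + y) <= 2 `^ p%:num * (gauge x + gauge y).
Proof.
have p0 : 0 < p%:num by [].
have := energyD mI (@subset_refl _ _) x y p0.
by rewrite -(gaugeE x) -(gaugeE y) -(gaugeE (x + y)) -EFinD -EFinM lee_fin.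
Qed.

Lemma Lpnorm_gauge x : Lpnorm x = gauge x `^ (p%:num)^-1.
Proof. by []. Qed.

Lemma Lpnorm_lt x (e : R) : 0 < e -> gauge x < e `^ p%:num -> Lpnorm x < e.
Proof.
move=> e0 xe; rewrite Lpnorm_gauge -[ltRHS](powRr1 (ltW e0)).
rewrite -(mulfV (lt0r_neq0 (gt0 p))) powRrM.
by apply: gt0_ltr_powR; rewrite ?invr_gt0 ?nnegrE ?gauge_ge0 ?powR_ge0.
Qed.

Lemma gauge_lt x (e : R) : 0 < e -> Lpnorm x < e `^ (p%:num)^-1 -> gauge x < e.
Proof.
move=> e0 xe; rewrite ltNge; apply/negP => ex; move: xe; apply/negP.
rewrite -leNgt Lpnorm_gauge.
by apply: ge0_ler_powR; rewrite ?invr_ge0 ?nnegrE ?gauge_ge0 ?(ltW e0).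
Qed.

Lemma closed_gauge (M : set E) : closed M <-> gauge_closed gauge M.
Proof.
have -> : closed M = Lp_open (~` M) by rewrite -{1}[M]setCK closedC.
split=> [oM x xM|cM x nMx]; apply: contrapT.
  move=> /oM[e e0 eM].
  have [y My ye] := xM _ (powR_gt0 p%:num e0).
  by apply: (eM y) => //; exact: Lpnorm_lt.
move=> ne; apply: nMx; apply: cM => e e0; apply: contrapT => nye; apply: ne.
exists (e `^ p%:num^-1); first exact: powR_gt0.
by move=> y /= /(gauge_lt e0) ye My; apply: nye; exists y.
Qed.

End LpElements.

(** * Functions integrable beyond the exponent p *)

Section Subspaces.
Variables (R : realType) (k : scalar_kind) (I : interval R) (p : {posnum R}).
Notation K := (scalar_field R k).
Notation mu := (@completed_lebesgue_measure R).
Notation lebR := (caratheodory_type (@wlength R idfun)^*%mu).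
Local Notation E := (Lp k I p).
Implicit Types (x y : E) (S : set lebR) (q : R).

Let mI : measurable ([set` I] : set lebR).
Proof. by apply: measurable_lebR; exact: measurable_itv. Qed.

Definition zero_on S : set E := [set x | eq_on S (rep x) (fun=> 0)].

Lemma subspace_zero_on S : S `<=` [set` I] -> vector_subspace (zero_on S).
Proof.
move=> SI; apply/vector_subspaceP; split; first exact: eq_on_sub (rep0 k I p).
move=> a x y x0 y0; apply: eq_on_trans (eq_on_sub SI (rep_ZD a x y)) _.
apply: filterS2 x0 y0 => t /[swap] + /[swap] St => /(_ St) -> /(_ St) ->.
by rewrite mulr0 addr0.
Qed.

Lemma zero_onB S x y : S `<=` [set` I] ->
  zero_on S (x - y) <-> eq_on S (rep x) (rep y).
Proof.
move=> SI; have h := eq_on_sub SI (rep_ZD (-1) y x).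
rewrite addrC -scaleN1r; split => xy.
  apply: filterS2 h xy => t /[swap] + /[swap] St => /(_ St) -> /(_ St) /esym/eqP.
  by rewrite mulN1r addrC subr_eq0 => /eqP.
apply: eq_on_trans h _; move: xy; apply: filterS => t /[apply] ->.
by rewrite mulN1r addNr.
Qed.

Lemma energy_eq0 S q x : measurable S -> S `<=` [set` I] ->
  energy S q x = 0%E -> zero_on S x.
Proof.
move=> mS SI x0; have := ae_eq_integral_abs mu mS (measurable_rep_on SI q x).
move=> [+ _]; rewrite (_ : (\int[mu]_(x0 in S) _)%E = energy S q x); last first.
  by apply: eq_integral => t _; rewrite gee0_abs// lee_fin powR_ge0.
move=> /(_ x0); apply: filterS => t /[apply] -[/eqP].
rewrite powR_eq0 => /andP[/eqP + _].
case: k (rep x t) => //= z; first exact: normr0_eq0.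
exact: ComplexField.Normc.eq0_normc.
Qed.

Lemma closed_zero_on S : measurable S -> S `<=` [set` I] ->
  gauge_closed (@gauge R k I p) (zero_on S).
Proof.
move=> mS SI x xS.
apply: (energy_eq0 (q := p%:num) mS SI); apply/eqP; rewrite eq_le energy_ge0 andbT.
apply/lee_addgt0Pr => e e0; rewrite add0e.
have [y y0 ye] := xS _ e0.
apply: (@le_trans _ _ (energy S p%:num (y - x))).
  rewrite -[leRHS]mul1e; apply: energy_le => //.
  have h := eq_on_sub SI (rep_ZD (-1) x y).
  rewrite [y - x]addrC -scaleN1r.
  apply: filterS2 h y0 => t /[swap] + /[swap] St => /(_ St) + /(_ St) -> => ->.
  by rewrite addr0 mulN1r modulusN mul1r.
apply: le_trans (energy_subset _ _ mS mI SI (@subset_refl _ _)) _.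
by rewrite -gaugeE lee_fin ltW.
Qed.

Definition higher_integrable S : set E :=
  [set x | exists2 q, p%:num < q & (energy S q x < +oo)%E].

Lemma higher_integrable_subset S S' : measurable S -> measurable S' ->
  S `<=` S' -> S' `<=` [set` I] ->
  higher_integrable S' `<=` higher_integrable S.
Proof.
move=> mS mS' SS' S'I x [q pq xq]; exists q => //.
by apply: le_lt_trans xq; exact: energy_subset.
Qed.

Lemma higher_integrable_zero_on S : measurable S -> S `<=` [set` I] ->
  zero_on S `<=` higher_integrable S.
Proof.
move=> mS SI x x0; exists (p%:num + 1); first by rewrite ltrDl.
rewrite (_ : energy S _ x = 0%E) ?ltry//.
have p1 : p%:num + 1 != 0 by rewrite gt_eqF// addr_gt0.
have z0 : (fun t : lebR => (modulus (0 : K) `^ (p%:num + 1))%:E) = cst 0%E.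
  by apply/funext => t; rewrite modulus0 powR0.
rewrite (energy_eq mS SI x0) z0; first by rewrite integral_cst// mul0e.
exact: measurable_cst.
Qed.

Hypothesis finI : (mu ([set` I] : set lebR) < +oo)%E.

(** Since [|x| ^ q' <= 1 + |x| ^ q], with [1] integrable on [S]. *)
Lemma energy_lt_le S q q' x : measurable S -> S `<=` [set` I] -> 0 < q' -> q' <= q ->
  (energy S q x < +oo)%E -> (energy S q' x < +oo)%E.
Proof.
move=> mS SI q'0 q'q xq.
have h : (energy S q' x <= mu S + energy S q x)%E.
  have ge0 (r : R) (t : lebR) : S t -> (0 <= (modulus (rep x t) `^ r)%:E)%E.
    by rewrite lee_fin powR_ge0.
  have one0 (t : lebR) : S t -> (0 <= cst 1%E t :> \bar R)%E by rewrite lee_fin ler01.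
  have m1 : measurable_fun S (cst 1%E : lebR -> \bar R) by exact: measurable_cst.
  have mq := measurable_rep_on SI q x.
  have mq1 : measurable_fun S
    (fun t : lebR => cst 1 t + (modulus (rep x t) `^ q)%:E)%E.
    exact: emeasurable_funD.
  have <- : (\int[mu]_(t in S) (cst 1 t + (modulus (rep x t) `^ q)%:E) =
    mu S + energy S q x)%E.
    rewrite (ge0_integralD mu mS one0 m1 (ge0 q) mq).
    by rewrite (integral_cst mu mS) mul1e.
  apply: (ge0_le_integral mu mS (ge0 q') (measurable_rep_on SI q' x) mq1).
  move=> t St; rewrite /= -EFinD lee_fin; set a := modulus _.
  have a0 : 0 <= a by exact: modulus_ge0.
  have [a1|a1] := leP a 1.
    rewrite (@le_trans _ _ 1) ?lerDl ?powR_ge0//.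
    have <- : 1 `^ q' = 1 :> R by rewrite powR1.
    by apply: ge0_ler_powR; rewrite ?nnegrE ?(ltW q'0).
  by rewrite (@le_trans _ _ (a `^ q)) ?lerDr// ler_powR// ltW.
apply: le_lt_trans h _; apply: lte_add_pinfty => //.
by apply: le_lt_trans finI; apply: le_measure; rewrite ?inE.
Qed.

(** The exponents of two members may differ; on a set of finite measure the
    smaller one serves for both. *)
Lemma subspace_higher_integrable S : measurable S -> S `<=` [set` I] ->
  vector_subspace (higher_integrable S).
Proof.
move=> mS SI; apply/vector_subspaceP; split.
  by apply: higher_integrable_zero_on => //; exact: eq_on_sub (rep0 k I p).
move=> a x y [q pq xq] [r pr yr].
have pm : p%:num < Num.min q r by rewrite lt_min pq.
have m0 : 0 < Num.min q r by exact: lt_trans pm.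
exists (Num.min q r); first exact: pm.
have xm : (energy S (Num.min q r) x < +oo)%E.
  by apply: energy_lt_le xq => //; rewrite ge_min lexx.
have ym : (energy S (Num.min q r) y < +oo)%E.
  by apply: energy_lt_le yr => //; rewrite ge_min lexx orbT.
apply: le_lt_trans (energyD mS SI _ _ m0) _.
rewrite (energyZ mS SI) lte_mul_pinfty ?lee_fin ?powR_ge0//.
by apply: lte_add_pinfty ym; rewrite lte_mul_pinfty ?lee_fin ?powR_ge0.
Qed.

Lemma higher_integrable_setU S S' : measurable S -> measurable S' -> S `<=` [set` I] ->
  S' `<=` [set` I] -> [disjoint S & S'] ->
  higher_integrable S `&` higher_integrable S' `<=` higher_integrable (S `|` S').
Proof.
move=> mS mS' SI S'I dSS' x [[q pq xq] [r pr xr]].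
have pm : p%:num < Num.min q r by rewrite lt_min pq.
have m0 : 0 < Num.min q r by exact: lt_trans pm.
exists (Num.min q r); first exact: pm.
have UI : S `|` S' `<=` [set` I] by move=> t [/SI|/S'I].
have ge0 (t : lebR) : (S `|` S') t ->
    (0 <= (modulus (rep x t) `^ Num.min q r)%:E)%E.
  by rewrite lee_fin powR_ge0.
rewrite /energy (ge0_integral_setU mu mS mS' (measurable_rep_on UI _ x) ge0 dSS').
apply: lte_add_pinfty.
  by apply: energy_lt_le xq => //; rewrite ge_min lexx.
by apply: energy_lt_le xr => //; rewrite ge_min lexx orbT.
Qed.

End Subspaces.

(** * Disjoint pieces and amplitudes *)

Section Scal.
Variables (R : realType) (k : scalar_kind).
Notation K := (scalar_field R k).
Notation lebR := (caratheodory_type (@wlength R idfun)^*%mu).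

Definition real_scalar : R -> K :=
  match k return R -> scalar_field R k with
  | RealScalars => fun x => x
  | ComplexScalars => fun x => x%:C%C
  end.

Lemma real_scalarM x y : real_scalar (x * y) = real_scalar x * real_scalar y.
Proof. by rewrite /real_scalar; case: k => //=; rewrite rmorphM. Qed.

Lemma real_scalarX x n : real_scalar (x ^+ n) = real_scalar x ^+ n.
Proof. by rewrite /real_scalar; case: k => //=; rewrite rmorphXn. Qed.

Lemma real_scalar1 : real_scalar 1 = 1.
Proof. by rewrite /real_scalar; case: k. Qed.

Lemma real_scalar0 : real_scalar 0 = 0.
Proof. by rewrite /real_scalar; case: k. Qed.

Lemma real_scalar_inj : injective real_scalar.
Proof. by rewrite /real_scalar; case: k => //= x y; exact: fmorph_inj. Qed.

Lemma modulus_real_scalar x : modulus (real_scalar x) = `|x|.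
Proof.
rewrite /real_scalar; case: k => //=.
by rewrite expr0n/= addr0 sqrtr_sqr.
Qed.

Lemma modulus_gt0 (x : K) : x != 0 -> 0 < modulus x.
Proof.
move=> x0; rewrite lt_neqAle modulus_ge0 andbT eq_sym; apply: contra x0.
case: k x => /= x; first by rewrite normr_eq0.
by move=> /eqP /ComplexField.Normc.eq0_normc ->.
Qed.

Lemma lebesgue_measurable_real_scalar (D : set R) (f : R -> R) :
  measurable_fun (D : set lebR) (f : lebR -> R) ->
  lebesgue_measurable D (fun t => real_scalar (f t)).
Proof.
by rewrite /lebesgue_measurable /real_scalar; case: k.
Qed.

End Scal.

Section Amplitudes.
Variable (R : realType) (p : R).
Hypothesis p0 : 0 < p.

(** The squares in the exponents matter: with [n = k + 1], the [q]-th power of the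
    amplitude times the length is [2 ^ (n ^ 2 * (q / p - 1) - n * q / p)], which
    tends to infinity for every [q > p], however close to [p]. *)
Definition piece_length (k : nat) : R := 2^-1 ^+ (k.+1 ^ 2).
Definition amplitude (k : nat) : R := (2 ^+ (k.+1 ^ 2 - k.+1)) `^ p^-1.

Lemma amplitude_gt0 k : 0 < amplitude k.
Proof. by rewrite powR_gt0// exprn_gt0. Qed.

Lemma piece_length_gt0 k : 0 < piece_length k.
Proof. by rewrite exprn_gt0// invr_gt0. Qed.

Lemma amplitude_powp k : amplitude k `^ p * piece_length k = 2^-1 ^+ k.+1.
Proof.
rewrite /amplitude -powRrM mulVf ?gt_eqF// powRr1 ?exprn_ge0//.
rewrite /piece_length -{2}(@subnK k.+1 (k.+1 ^ 2)%N); last by lia.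
by rewrite exprD mulrA -exprMn mulfV// expr1n mul1r.
Qed.

Lemma amplitude_unbounded q (M : R) : p < q ->
  exists N, forall k, (N <= k)%N -> M <= amplitude k `^ q * piece_length k.
Proof.
move=> pq; pose r := q / p - 1.
have r0 : 0 < r by rewrite subr_gt0 ltr_pdivlMr// mul1r.
(* [n >= (2 + r) / r] makes the exponent at least [n], and [2 ^ n >= n >= M]. *)
exists (Num.truncn (`|M| + (2 + r) / r)) => k Nk.
set n := k.+1.
have nM : `|M| + (2 + r) / r < n%:R.
  by apply: lt_le_trans (truncnS_gt _) _; rewrite ler_nat ltnS.
have nr : (2 + r) / r <= n%:R by apply: le_trans (ltW nM); rewrite lerDr.
have -> : amplitude k `^ q * piece_length k = 2 `^ (n%:R * (n%:R * r - (1 + r))).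
  rewrite /amplitude /piece_length -/n -powR_mulrn// -!powRrM.
  rewrite exprVn -powR_mulrn// -powRN -powRD ?pnatr_eq0 ?implybT//.
  congr (2 `^ _); rewrite natrB; last by lia.
  rewrite natrX /r; field.
  by rewrite gt_eqF.
have n1 : n%:R <= n%:R * (n%:R * r - (1 + r)).
  rewrite ler_peMr// lerBrDr addrA (_ : 1 + 1 = 2)//.
  by rewrite -ler_pdivrMr.
apply: le_trans (ler_norm M) _; apply: (@le_trans _ _ (2 `^ n%:R)).
  apply: (@le_trans _ _ n%:R).
    apply: le_trans (ltW nM); rewrite lerDl.
    by apply: divr_ge0; [apply: addr_ge0 => //|]; exact: ltW.
  by rewrite powR_mulrn// -natrX ler_nat ltnW// ltn_expl.
by rewrite ler_powR// ler1n.
Qed.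

End Amplitudes.

Section Pieces.
Variable R : realType.
Notation mu := (@completed_lebesgue_measure R).
Notation lebR := (caratheodory_type (@wlength R idfun)^*%mu).

Definition piece (k : nat) : set R :=
  `]2^-1 ^+ k.+1, 2^-1 ^+ k.+1 + piece_length R k].

Let half0 n : 0 < 2^-1 ^+ n :> R.
Proof. by rewrite exprn_gt0// invr_gt0. Qed.

Let half_le n m : (n <= m)%N -> 2^-1 ^+ m <= 2^-1 ^+ n :> R.
Proof. by move=> nm; rewrite ler_wiXn2l// invf_le1// ler1n. Qed.

Lemma measurable_piece k : measurable (piece k : set lebR).
Proof. by apply: measurable_lebR; exact: measurable_itv. Qed.

Lemma mu_itv (i : interval R) :
  mu ([set` i] : set lebR) = lebesgue_measure ([set` i] : set R).
Proof. by []. Qed.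

Lemma mu_piece k : mu (piece k : set lebR) = (piece_length R k)%:E.
Proof.
rewrite mu_itv lebesgue_measure_itv/= lte_fin ltrDl piece_length_gt0.
by rewrite -EFinB addrAC subrr add0r.
Qed.

Let piece_le k : 2^-1 ^+ k.+1 + piece_length R k <= 2^-1 ^+ k.
Proof.
have : piece_length R k <= 2^-1 ^+ k.+1 by apply: half_le; lia.
by rewrite exprS; lra.
Qed.

Lemma piece_sub k : piece k `<=` `[0%R, 1%R].
Proof.
move=> t; rewrite /piece/= !in_itv/= => /andP[t1 t2].
rewrite (le_trans (ltW (half0 _)) (ltW t1))/=.
by apply: le_trans t2 (le_trans (piece_le k) _); exact: half_le (leq0n k).
Qed.

Lemma piece_trivIset : trivIset setT piece.
Proof.
suff lt j k t : (j < k)%N -> piece j t -> ~ piece k t.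
  apply/trivIsetP => j k _ _ jk; apply/seteqP; split => // t [tj tk].
  have [/lt/(_ tj)//|kj|e] := ltngtP j k; first exact: (lt _ _ _ kj tk).
  by rewrite e eqxx in jk.
move=> jk; rewrite /piece/= !in_itv/= => /andP[t1 _] /andP[_ t2].
have := lt_le_trans t1 t2; apply/negP; rewrite -leNgt.
by apply: le_trans (piece_le k) _; exact: half_le.
Qed.

Lemma piece_inj j k t : piece j t -> piece k t -> j = k.
Proof. by move=> tj tk; apply: (piece_trivIset) => //; exists t. Qed.

Definition piecewise (c : nat -> R) (t : R) : R :=
  if pselect (exists k, piece k t) is left h then c (projT1 (cid h)) else 0.

Lemma piecewiseE c k t : piece k t -> piecewise c t = c k.
Proof.
move=> tk; rewrite /piecewise; case: pselect => [h|]; last by case; exists k.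
by congr c; apply: piece_inj tk; exact: (projT2 (cid h)).
Qed.

Lemma piecewise0 c t : ~ (\bigcup_k piece k) t -> piecewise c t = 0.
Proof.
by move=> nt; rewrite /piecewise; case: pselect => // -[k kt]; case: nt; exists k.
Qed.

Lemma measurable_pieces : measurable (\bigcup_k piece k : set lebR).
Proof. by apply: bigcupT_measurable => k; exact: measurable_piece. Qed.

Lemma pieces_sub : \bigcup_k piece k `<=` `[0%R, 1%R].
Proof. by apply: bigcup_sub => k _; exact: piece_sub. Qed.

Let m01 : measurable ((`[0%R, 1%R]%classic : set R) : set lebR).
Proof. by apply: measurable_lebR; exact: measurable_itv. Qed.

Let mrest : measurable (`[0%R, 1%R] `\` \bigcup_k piece k : set lebR).
Proof. exact: measurableD m01 measurable_pieces. Qed.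

Lemma measurable_piecewise c :
  measurable_fun ((`[0%R, 1%R]%classic : set R) : set lebR) (piecewise c : lebR -> R).
Proof.
rewrite -(setDUK pieces_sub); apply/(measurable_funU _ measurable_pieces mrest).
split; last first.
  apply: (@eq_measurable_fun _ _ lebR R _ (cst 0)); last exact: measurable_cst.
  by move=> t /set_mem[_ /piecewise0 ->].
apply/(measurable_fun_bigcup _ measurable_piece) => k.
apply: (@eq_measurable_fun _ _ lebR R _ (cst (c k))); last exact: measurable_cst.
by move=> t /set_mem /piecewiseE ->.
Qed.

Variables (k : scalar_kind) (p : {posnum R}).

(** The [n]-th piece contributes at most [2 ^ -(n + 1)] to the integral
    ([amplitude_powp]). *)
Lemma p_integrable_piecewise c : (forall n, `|c n| <= amplitude p%:num n) ->
  p_integrable (k := k) `[0%R, 1%R] p%:num (fun t => real_scalar k (piecewise c t)).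
Proof.
move=> ca; have mc : measurable_fun ((`[0%R, 1%R]%classic : set R) : set lebR)
    (fun t : lebR => (`|piecewise c t| `^ p%:num)%:E).
  apply/measurable_EFinP; apply: (@measurableT_comp _ _ _ _ _ _ (@powR R ^~ p%:num)).
    exact: measurable_powR.
  by apply: measurableT_comp => //; exact: measurable_piecewise.
rewrite /p_integrable (_ : (fun t : lebR => _) =
    (fun t : lebR => (`|piecewise c t| `^ p%:num)%:E)); last first.
  by apply/funext => t; rewrite modulus_real_scalar.
have c0 (t : lebR) : (0 <= (`|piecewise c t| `^ p%:num)%:E)%E.
  by rewrite lee_fin powR_ge0.
apply/integrableP; split; first exact: mc.
rewrite (_ : (fun t : lebR => _) =
    (fun t : lebR => (`|piecewise c t| `^ p%:num)%:E)); last first.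
  by apply/funext => t; rewrite gee0_abs.
move: mc; rewrite [X in measurable_fun X](esym (setDUK pieces_sub)).
rewrite -[X in integral _ X](setDUK pieces_sub) => mc.
have dj : [disjoint \bigcup_k piece k & `[0%R, 1%R] `\` \bigcup_k piece k].
  by apply/disj_setPS => t [? []].
rewrite (ge0_integral_setU mu measurable_pieces mrest mc _ dj); last first.
  by move=> t _; exact: c0.
rewrite [X in (_ + X)%E](_ : _ = 0%E) ?adde0; last first.
  rewrite -[RHS](integral0 mu (`[0%R, 1%R] `\` \bigcup_k piece k)).
  apply: eq_integral => t /set_mem[_ /piecewise0 ->].
  by rewrite normr0 powR0 ?gt_eqF.
have mc' := (measurable_funU _ measurable_pieces mrest).1 mc.
rewrite (ge0_integral_bigcup mu measurable_piece mc'.1 _ piece_trivIset); last first.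
  by move=> t _; exact: c0.
apply: (@le_lt_trans _ _ (\sum_(0 <= n <oo) (1 / (2 ^ n.+1)%:R)%:E)%E); last first.
  by apply: le_lt_trans (epsilon_trick0 _ ler01) _; rewrite ltry.
apply: lee_nneseries => [n _ _|n _]; first by apply: integral_ge0 => t _; exact: c0.
rewrite (_ : integral _ _ _ =
    \int[mu]_(t in piece n) cst ((`|c n| `^ p%:num)%:E) t)%E; last first.
  by apply: eq_integral => t /set_mem /piecewiseE ->.
rewrite (integral_cst mu (measurable_piece n)).
rewrite [X in (_ * X)%E](mu_piece n) -EFinM lee_fin.
apply: (@le_trans _ _ (amplitude p%:num n `^ p%:num * piece_length R n)).
  rewrite ler_wpM2r ?(ltW (piece_length_gt0 _ _))//.
  by rewrite ge0_ler_powR ?nnegrE ?(ltW (amplitude_gt0 _ _)).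
by rewrite amplitude_powp// div1r natrX exprVn.
Qed.

Local Notation E := (Lp k `[0%R, 1%R] p).

Lemma Lp_piecewise c : (forall n, `|c n| <= amplitude p%:num n) ->
  exists x : E, eq_on `[0%R, 1%R] (rep x) (fun t => real_scalar k (piecewise c t)).
Proof.
move=> ca; apply: Lp_of_fun; last exact: p_integrable_piecewise.
exact: (lebesgue_measurable_real_scalar k (measurable_piecewise c)).
Qed.

(** For [q > p] the single pieces inside [S] already carry arbitrarily large
    [q]-energy ([amplitude_unbounded]). *)
Lemma not_higher_integrable (S : set lebR) (x : E) (c : scalar_field R k) :
  measurable S -> S `<=` `[0%R, 1%R] -> c != 0 ->
  (forall N, exists n, [/\ (N <= n)%N, piece n `<=` S &
    eq_on (piece n) (rep x) (fun=> c * real_scalar k (amplitude p%:num n))]) ->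
  ~ higher_integrable S x.
Proof.
move=> mS SI c0 xc [q pq] xq.
have p0 : 0 < p%:num by [].
have mcq : 0 < modulus c `^ q by rewrite powR_gt0// modulus_gt0.
have xfin : energy S q x \is a fin_num by rewrite ge0_fin_numE// energy_ge0.
have [N NM] := amplitude_unbounded p0 ((fine (energy S q x) + 1) / modulus c `^ q) pq.
have [n [/NM nM nS xn]] := xc N.
have : ((modulus c `^ q * (amplitude p%:num n `^ q * piece_length R n))%:E
    <= energy S q x)%E.
  apply: (le_trans _ (energy_subset _ _ (measurable_piece n) mS nS SI)).
  rewrite (energy_eq (measurable_piece n) (@piece_sub n) xn); last exact: measurable_cst.
  rewrite (integral_cst mu (measurable_piece n)).
  rewrite [X in (_ * X)%E](mu_piece n) -EFinM lee_fin.
  rewrite modulusM modulus_real_scalar ger0_norm ?(ltW (amplitude_gt0 _ _))//.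
  by rewrite powRM ?modulus_ge0 ?(ltW (amplitude_gt0 _ _))// mulrA.
rewrite -(fineK xfin) lee_fin; apply/negP; rewrite -ltNge.
by move: nM; rewrite ler_pdivrMr// mulrC; apply: lt_le_trans; rewrite ltrDl.
Qed.

End Pieces.

(** * Zones, blocks and the closed spaces they carry *)

Section Construction.
Variables (R : realType) (k : scalar_kind) (p : {posnum R}).
Notation K := (scalar_field R k).
Notation mu := (@completed_lebesgue_measure R).
Notation lebR := (caratheodory_type (@wlength R idfun)^*%mu).
Notation I := (`[0%R, 1%R] : interval R).
Local Notation E := (Lp k I p).
Local Notation V := (higher_integrable [set` I] : set E).
Local Notation slot i j l := (@pickle (nat * nat * nat)%type (i, j, l)).
Implicit Types (x y : E).

Lemma eq_on_bigcup (F : nat -> set lebR) (f g : R -> K) :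
  (forall n, eq_on (F n) f g) -> eq_on (\bigcup_n F n) f g.
Proof.
move=> fg; have : {ae mu, forall t : lebR, forall n, F n t -> f t = g t}.
  exact/ae_foralln.
by apply: filterS => t h [n _]; exact: h.
Qed.

Let mI : measurable ([set` I] : set lebR).
Proof. by apply: measurable_lebR; exact: measurable_itv. Qed.

Lemma mu_unit_itv : mu ([set` I] : set lebR) = 1%E.
Proof.
rewrite mu_itv lebesgue_measure_itv/= lte_fin ltr01.
by rewrite -EFinB subr0.
Qed.

Lemma unit_itv_fin : (mu ([set` I] : set lebR) < +oo)%E.
Proof. by rewrite [ltLHS]mu_unit_itv ltry. Qed.

(** The third component of the triples coded by [pickle] runs over infinitely many
    pieces for each pair [(i, j)]. *)
Definition block (i j : nat) : set R := \bigcup_l @piece R (slot i j l).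
Definition zone i : set R := \bigcup_j block i j.

Lemma block_sub i j : block i j `<=` [set` I].
Proof. by apply: bigcup_sub => l _; exact: piece_sub. Qed.

Lemma measurable_block i j : measurable (block i j : set lebR).
Proof. by apply: bigcupT_measurable => l; exact: measurable_piece. Qed.

Lemma zone_sub i : zone i `<=` [set` I].
Proof. by apply: bigcup_sub => j _; exact: block_sub. Qed.

Lemma block_zone i j : block i j `<=` zone i.
Proof. exact: bigcup_sup. Qed.

Lemma measurable_zone i : measurable (zone i : set lebR).
Proof. by apply: bigcupT_measurable => j; exact: measurable_block. Qed.

Lemma measurable_rest i : measurable ([set` I] `\` zone i : set lebR).
Proof. by apply: measurableD => //; exact: measurable_zone. Qed.

Lemma rest_sub i : [set` I] `\` zone i `<=` [set` I].
Proof. exact: subDsetl. Qed.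

Lemma zone_disj i j : i != j -> zone i `<=` [set` I] `\` zone j.
Proof.
move=> ij t [a _ [l _ tal]]; split; first exact: piece_sub tal.
move=> [b _ [m _ tbm]].
have /(pcan_inj pickleK)[e _ _] := piece_inj tal tbm.
by rewrite e eqxx in ij.
Qed.

Lemma block_far i j N :
  exists2 n, (N <= n)%N & @piece R n `<=` block i j.
Proof.
have inj : injective (fun l : nat => slot i j l).
  by move=> l m /(pcan_inj pickleK)[].
have [l Nl] := injective_gtn inj N.
by exists (slot i j l); [exact: ltnW|exact: (bigcup_sup (i := l))].
Qed.

Lemma spike_exists : exists f : E, forall n,
  eq_on (@piece R n) (rep f) (fun=> real_scalar k (amplitude p%:num n)).
Proof.
have [|f fP] := @Lp_piecewise R k p (amplitude p%:num).
  by move=> n; rewrite ger0_norm// ltW// amplitude_gt0.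
exists f => n; apply: eq_on_trans (eq_on_sub (@piece_sub R n) fP) _.
by apply: aeW => t /piecewiseE ->.
Qed.

Definition spike : E := projT1 (cid spike_exists).

Lemma spikeE n :
  eq_on (@piece R n) (rep spike) (fun=> real_scalar k (amplitude p%:num n)).
Proof. exact: (projT2 (cid spike_exists)). Qed.

Lemma not_higher_integrable_block i j x (b : K) : b != 0 ->
  eq_on (block i j) (rep x) (fun t => b * rep spike t) ->
  ~ higher_integrable (block i j) x.
Proof.
move=> b0 xb.
apply: (not_higher_integrable (measurable_block i j) (@block_sub i j) b0) => N.
have [n Nn nb] := block_far i j N; exists n; split => //.
apply: eq_on_trans (eq_on_sub nb xb) _.
by move: (spikeE n); apply: filterS => t /[apply] ->.
Qed.

(** Written as an intersection of sets of the form [M + K spike] with [M] the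
    functions vanishing on a block, so that closedness follows from
    [gauge_closed_add_line] without handling the sequence of coefficients. *)
Definition block_multiples i : set E := zero_on ([set` I] `\` zone i) `&`
  \bigcap_j add_line (zero_on (block i j)) spike.

Lemma subspace_block_multiples i : vector_subspace (block_multiples i).
Proof.
apply: subspaceI; first by apply: subspace_zero_on; exact: rest_sub.
apply: subspace_bigcap => j; apply: subspace_add_line.
by apply: subspace_zero_on; exact: block_sub.
Qed.

Lemma closed_add_line (M : set E) v : vector_subspace M ->
  gauge_closed (@gauge R k I p) M -> gauge_closed (@gauge R k I p) (add_line M v).
Proof.
apply: gauge_closed_add_line; [|exact: (powR_gt0 p%:num (ltr0Sn R 1))|
  exact: gauge_ge0|exact: gaugeZ|exact: gaugeD].
by [].
Qed.

Lemma closed_block_multiples i : gauge_closed (@gauge R k I p) (block_multiples i).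
Proof.
apply: gauge_closedI.
  by apply: closed_zero_on; [exact: measurable_rest|exact: rest_sub].
apply: gauge_closed_bigcap => j; apply: closed_add_line.
  by apply: subspace_zero_on; exact: block_sub.
by apply: closed_zero_on; [exact: measurable_block|exact: block_sub].
Qed.

Lemma block_multipleE i j x b : zero_on (block i j) (x - b *: spike) <->
  eq_on (block i j) (rep x) (fun t => b * rep spike t).
Proof.
rewrite (zero_onB _ _ (@block_sub i j)).
have bspike := eq_on_sub (@block_sub i j) (repZ b spike).
split=> [xb|xb]; first exact: eq_on_trans bspike.
by apply: eq_on_trans xb _; exact: eq_on_sym.
Qed.

Lemma block_multiples_eq0 i x :
  block_multiples i x -> (forall j, zero_on (block i j) x) -> x = 0.
Proof.
move=> [xr _] xb; apply: rep_inj; apply: eq_on_trans _ (eq_on_sym (rep0 k I p)).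
have xz : eq_on (zone i) (rep x) (fun=> 0) by exact: eq_on_bigcup.
apply: filterS2 xr xz => t hr hz It.
by have [/hz|/(conj It)/hr] := pselect (zone i t).
Qed.

(** On a block where [x] is a nonzero multiple of [spike] it is not
    [q]-integrable, so all the coefficients of [x] vanish. *)
Lemma block_multiples_higher_integrable i x :
  block_multiples i x -> higher_integrable (zone i) x -> x = 0.
Proof.
move=> xt xz; apply: (block_multiples_eq0 xt) => j.
have [b /block_multipleE xb] := xt.2 j Logic.I.
have [b0|b0] := eqVneq b 0; last first.
  case: (not_higher_integrable_block b0 xb).
  by apply: higher_integrable_subset xz; [exact: measurable_block|
    exact: measurable_zone|exact: block_zone|exact: zone_sub].
by apply: eq_on_trans xb _; apply: aeW => t _; rewrite b0 mul0r.
Qed.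

(** Indexes the ratios in the open unit interval by all the reals. *)
Definition sigmoid (s : R) : R := (1 + expR s)^-1.

Let sigmoid0 s : 0 < sigmoid s.
Proof. by rewrite invr_gt0 addr_gt0// expR_gt0. Qed.

Let sigmoid1 s : sigmoid s <= 1.
Proof. by rewrite invf_le1 ?addr_gt0 ?expR_gt0// lerDl expR_ge0. Qed.

Lemma sigmoid_inj : injective sigmoid.
Proof. by move=> s t /invr_inj/addrI/expR_inj. Qed.

Lemma geom_exists : exists u : nat -> R -> E, forall i s,
  block_multiples i (u i s) /\
  forall j, eq_on (block i j) (rep (u i s))
    (fun t => real_scalar k (sigmoid s) ^+ j * rep spike t).
Proof.
suff h i s : exists x, block_multiples i x /\
  forall j, eq_on (block i j) (rep x)
    (fun t => real_scalar k (sigmoid s) ^+ j * rep spike t).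
  have /choice[u uP] : forall is_ : nat * R, exists x,
      block_multiples is_.1 x /\
      forall j, eq_on (block is_.1 j) (rep x)
        (fun t => real_scalar k (sigmoid is_.2) ^+ j * rep spike t).
    by move=> [i s]; exact: h.
  by exists (fun i s => u (i, s)) => i s; exact: (uP (i, s)).
pose c n : R := if @pickle_inv (nat * nat * nat)%type n is Some (i', j, _) then
  if i' == i then sigmoid s ^+ j * amplitude p%:num n else 0 else 0.
have ca n : `|c n| <= amplitude p%:num n.
  rewrite /c; case: (pickle_inv n) => [[[i' j] _]|]; last first.
    by rewrite normr0 ltW// amplitude_gt0.
  case: ifP => _; last by rewrite normr0 ltW// amplitude_gt0.
  rewrite ger0_norm; last first.
    by rewrite mulr_ge0 ?exprn_ge0 ?(ltW (sigmoid0 _)) ?(ltW (amplitude_gt0 _ _)).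
  by rewrite ler_piMl ?(ltW (amplitude_gt0 _ _))// exprn_ile1// ltW.
have [x xP] := Lp_piecewise k ca.
have xb j : eq_on (block i j) (rep x)
    (fun t => real_scalar k (sigmoid s) ^+ j * rep spike t).
  apply: eq_on_bigcup => l.
  apply: filterS2 (eq_on_sub (@piece_sub _ _) xP) (spikeE (slot i j l)) => t.
  move=> /[swap] + /[swap] tl => /(_ tl) -> /(_ tl) ->.
  by rewrite (piecewiseE _ tl) /c pickleK_inv eqxx real_scalarM real_scalarX.
exists x; split => //; split; last first.
  by move=> j _; exists (real_scalar k (sigmoid s) ^+ j); apply/block_multipleE.
apply: eq_on_trans (eq_on_sub (@rest_sub i) xP) _.
apply: aeW => t [It nt].
have [[n _ tn]|tp] := pselect ((\bigcup_n @piece R n) t); last first.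
  by rewrite piecewise0// real_scalar0.
rewrite (piecewiseE _ tn) /c; have := @pickle_invK (nat * nat * nat)%type n.
case: (pickle_inv n) => [[[i' j] l]|] /=; last by rewrite real_scalar0.
case: eqP => [->|_]; last by rewrite real_scalar0.
by move=> e; case: nt; exists j => //; exists l => //; rewrite e.
Qed.

Definition geom : nat -> R -> E := projT1 (cid geom_exists).

Lemma geom_block_multiples i s : block_multiples i (geom i s).
Proof. exact: (projT2 (cid geom_exists) i s).1. Qed.

Lemma geom_block i j s :
  eq_on (block i j) (rep (geom i s))
    (fun t => real_scalar k (sigmoid s) ^+ j * rep spike t).
Proof. exact: (projT2 (cid geom_exists) i s).2. Qed.

(** Vanishing power sums with weights [c] extend to weighted sums of values of
    polynomials; the product of all linear factors but one isolates a weight. *)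
Lemma power_sums_eq0 (J : eqType) (s : seq J) (c a : J -> K) : injective a ->
  uniq s -> (forall j, \sum_(b <- s) c b * a b ^+ j = 0) ->
  forall b, b \in s -> c b = 0.
Proof.
move=> ai us cs b bs.
have cp (P : {poly K}) : \sum_(b <- s) c b * P.[a b] = 0.
  under eq_bigr => d _ do rewrite horner_coef mulr_sumr.
  rewrite exchange_big/= big1// => j _.
  under eq_bigr => d _ do rewrite mulrCA.
  by rewrite -mulr_sumr cs mulr0.
have := cp (\prod_(z <- map a (rem b s)) ('X - z%:P)).
rewrite (big_rem b bs)/= [X in _ + X]big1_seq ?addr0.
  move=> /eqP; rewrite mulf_eq0 => /orP[/eqP//|].
  by rewrite -/(root _ _) root_prod_XsubC mem_map// mem_rem_uniqF.
move=> d /= ds; apply/eqP.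
by rewrite mulf_eq0 -/(root _ _) root_prod_XsubC mem_map// ds orbT.
Qed.

Lemma subspaceV : vector_subspace V.
Proof. by apply: subspace_higher_integrable => //; exact: unit_itv_fin. Qed.

Lemma geom_sum i j (s : seq R) (c : R -> K) :
  eq_on (block i j) (rep (\sum_(b <- s) c b *: geom i b))
    (fun t => (\sum_(b <- s) c b * real_scalar k (sigmoid b) ^+ j) * rep spike t).
Proof.
elim: s => [|b s IH].
  rewrite !big_nil; apply: eq_on_trans (eq_on_sub (@block_sub i j) (rep0 k I p)) _.
  by apply: aeW => t _; rewrite mul0r.
rewrite !big_cons.
apply: eq_on_trans (eq_on_sub (@block_sub i j) (rep_ZD _ _ _)) _.
apply: filterS2 IH (geom_block i j b) => t /[swap] + /[swap] tb => /(_ tb) -> /(_ tb) ->.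
by rewrite mulrA -mulrDl.
Qed.

(** If a combination of the [geom i b] is in [V], its multiplier of [spike] on
    every block is [0]; these multipliers are the power sums of the ratios. *)
Lemma indep_geom i : indep_mod V (geom i) setT.
Proof.
move=> s c us _ Vs; apply: (@power_sums_eq0 _ s c (real_scalar k \o sigmoid)) => //.
  exact: inj_comp (@real_scalar_inj R k) sigmoid_inj.
move=> j /=; apply: contrapT => /eqP s0.
apply: (not_higher_integrable_block s0 (geom_sum i j s c)).
apply: higher_integrable_subset Vs; [exact: measurable_block|exact: mI|
  exact: block_sub|exact: subset_refl].
Qed.

End Construction.

(** * Closed extensions of finite-dimensional subspaces *)

Section Final.
Variables (R : realType) (k : scalar_kind) (p : {posnum R}).
Notation K := (scalar_field R k).
Notation mu := (@completed_lebesgue_measure R).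
Notation lebR := (caratheodory_type (@wlength R idfun)^*%mu).
Notation I := (`[0%R, 1%R] : interval R).
Local Notation E := (Lp k I p).
Local Notation V := (higher_integrable [set` I] : set E).
Implicit Types (x y : E).

Let mI : measurable ([set` I] : set lebR).
Proof. by apply: measurable_lebR; exact: measurable_itv. Qed.

Definition Lp_only : set E := [set f : E | (Lp_set k I p%:num `\`
       \bigcup_(q in [set q : R | p%:num < q]) Lp_set k I q) (Lp_val f)].

Lemma Lp_setE q x : Lp_set k I q (Lp_val x) <-> (energy [set` I] q x < +oo)%E.
Proof.
have -> : energy [set` I] q x =
    (\int[mu]_(t in ([set` I] : set lebR)) `|(modulus (rep x t) `^ q)%:E|)%E.
  by apply: eq_integral => t _; rewrite gee0_abs// lee_fin powR_ge0.
split=> [/integrableP[_ xq]|xq]; first exact: xq.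
by apply/integrableP; split; [exact: measurable_rep|exact: xq].
Qed.

Lemma Lp_onlyE x : Lp_only x <-> ~ V x.
Proof.
split=> [[_ nx] [q pq /Lp_setE xq]|nx]; first by apply: nx; exists q.
split; first exact/Lp_setE/energy_Lp.
by move=> [q pq /Lp_setE xq]; apply: nx; exists q.
Qed.

Lemma sub_Lp_only0 (F : set E) :
  F `<=` Lp_only `|` [set 0] <-> forall x, F x -> V x -> x = 0.
Proof.
split=> [Fw x Fx Vx|FV x Fx]; first by have [/Lp_onlyE|] := Fw x Fx.
by have [Vx|/Lp_onlyE] := pselect (V x); [right; exact: FV|left].
Qed.

Definition add_lines (s : seq E) (M : set E) : set E :=
  foldr (fun v M' => add_line M' v) M s.

Lemma subspace_add_lines s M : vector_subspace M -> vector_subspace (add_lines s M).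
Proof. by move=> sM; elim: s => //= v s IH; exact: subspace_add_line. Qed.

Lemma gauge_closed_add_lines s M :
  vector_subspace M -> gauge_closed (@gauge R k I p) M ->
  gauge_closed (@gauge R k I p) (add_lines s M).
Proof.
move=> sM cM; elim: s => //= v s IH; apply: closed_add_line => //.
exact: subspace_add_lines.
Qed.

Lemma sub_add_lines s M : M `<=` add_lines s M.
Proof. by elim: s => //= v s IH; apply: subset_trans IH _; exact: sub_add_line. Qed.

Lemma mem_add_lines s M : vector_subspace M -> [set` s] `<=` add_lines s M.
Proof.
move=> sM; elim: s => //= v s IH x /=; rewrite inE => /orP[/eqP ->|/IH xs].
  by apply: mem_add_line; exact: subspace_add_lines.
exact: sub_add_line.
Qed.

Lemma add_lines_decomp s M x : add_lines s M x ->
  exists c : nat -> K, M (x - \sum_(n < size s) c n *: nth 0 s n).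
Proof.
elim: s x => [|v s IH] x /=.
  by move=> Mx; exists (fun=> 0); rewrite big_ord0 subr0.
move=> [a /IH[c Mc]]; exists (fun n => if n is m.+1 then c m else a).
by rewrite big_ord_recl/= opprD addrA.
Qed.

Section Adjoin.
Variables (i : nat) (s : seq E).
Let H := add_lines s (block_multiples i).

(** An element is coded by its coefficients on [s] followed by its multipliers on
    the blocks. *)
Lemma has_dim_add_lines_block_multiples : has_dim H [set: R].
Proof.
have tame0 := subspace_block_multiples k p i.
have /choice[d dP] : forall x, exists d : (nat -> K) * (nat -> K), H x ->
    let y := x - \sum_(n < size s) d.1 n *: nth 0 s n in
    block_multiples i y /\ forall j, zero_on (block i j) (y - d.2 j *: spike k p).
  move=> x; have [Hx|] := pselect (H x); last by exists (fun=> 0, fun=> 0).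
  have [c yt] := add_lines_decomp Hx.
  have /choice[b bP] := fun j => yt.2 j Logic.I.
  by exists (c, b).
apply: (@has_dim_continuum R k _ H (geom k p i)
  (fun x n => if (n < size s)%N then (d x).1 n else (d x).2 (n - size s)%N)).
- exact: subspace_add_lines.
- move=> t c ut tT t0; apply: (indep_geom ut tT (i := i) (k := k) (p := p)).
  by rewrite t0; apply: subspace0; exact: subspaceV.
- by move=> _ [t _ <-]; apply: sub_add_lines; exact: geom_block_multiples.
move=> x x' /set_mem/dP[xt xb] /set_mem/dP[x't x'b] xx'.
have c12 : \sum_(n < size s) (d x).1 n *: nth 0 s n =
    \sum_(n < size s) (d x').1 n *: nth 0 s n.
  apply: eq_bigr => n _; congr (_ *: _).
  by have := congr1 (@^~ (val n)) xx'; rewrite /= ltn_ord.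
have b12 j : (d x).2 j = (d x').2 j.
  have := congr1 (@^~ (size s + j)%N) xx'.
  by rewrite /= ltnNge leq_addr/= addKn.
rewrite c12 in xt xb; set f := \sum_(n < _) _ in xt xb x't x'b.
apply/subr0_eq; rewrite -[x](subrK f) -addrA -[f - x']opprB.
apply: (@block_multiples_eq0 R k p i); first exact: (subspaceB tame0 xt x't).
move=> j; have sb : vector_subspace (zero_on (block i j) : set E).
  by apply: subspace_zero_on; exact: block_sub.
rewrite (_ : _ - _ = (x - f - (d x).2 j *: spike k p) -
    (x' - f - (d x').2 j *: spike k p)).
  exact: subspaceB.
by rewrite b12 (opprB (x' - f)) [RHS]addrA subrK.
Qed.

(** Off the zone only the component in the span of [s] is left, and it must vanish
    there by the choice of the zone; what remains is a block multiple. *)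
Lemma add_lines_block_multiples_higher_integrable :
  (forall x, lin_span [set` s] x -> V x -> x = 0) ->
  (forall x, lin_span [set` s] x ->
    higher_integrable ([set` I] `\` zone i) x -> x = 0) ->
  forall x, H x -> V x -> x = 0.
Proof.
move=> FV Fi x /add_lines_decomp[c]; set f := \sum_(n < _) _ => yt Vx.
have Ff : lin_span [set` s] f.
  have sF := subspace_lin_span [set` s].
  apply: subspace_sum => // n _ _; apply: subspaceZ => //.
  by apply: sub_lin_span; exact: mem_nth.
have rI := @rest_sub R i; have mr := measurable_rest (R := R) i.
have f0 : f = 0.
  apply: (Fi _ Ff); rewrite -[f](subKr x).
  have sb : vector_subspace (higher_integrable ([set` I] `\` zone i) : set E).
    exact: (subspace_higher_integrable k p (unit_itv_fin R) mr rI).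
  apply: (subspaceB sb).
    exact: (higher_integrable_subset mr mI rI (@subset_refl _ _) Vx).
  exact: (higher_integrable_zero_on mr rI yt.1).
move: yt; rewrite f0 subr0 => xt; apply: (block_multiples_higher_integrable xt).
exact: (higher_integrable_subset (measurable_zone i) mI (@zone_sub R i)
  (@subset_refl _ _) Vx).
Qed.

End Adjoin.

Lemma finite_escape (s : seq E) : uniq s ->
  (forall x, lin_span [set` s] x -> V x -> x = 0) ->
  exists i, forall x, lin_span [set` s] x ->
    higher_integrable ([set` I] `\` zone i) x -> x = 0.
Proof.
move=> us; apply: (finite_dim_escape (W := fun i => higher_integrable (zone i))) => //.
- move=> i; apply: subspace_higher_integrable;
    [exact: unit_itv_fin|exact: measurable_zone|exact: zone_sub].
- move=> i x xr xz; have <- := setDUK (@zone_sub R i).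
  apply: higher_integrable_setU; [exact: unit_itv_fin|exact: measurable_zone|
    exact: measurable_rest|exact: zone_sub|exact: rest_sub| |by split].
  by apply/disj_setPS => t [? []].
- move=> i j ij; apply: higher_integrable_subset;
    [exact: measurable_zone|exact: measurable_rest|exact: zone_disj|exact: rest_sub].
Qed.

End Final.

(** * Spaceability and its failure *)

Section Main.
Variables (R : realType) (k : scalar_kind) (p : {posnum R}).
Notation K := (scalar_field R k).
Notation mu := (@completed_lebesgue_measure R).
Notation lebR := (caratheodory_type (@wlength R idfun)^*%mu).
Notation I := (`[0%R, 1%R] : interval R).
Local Notation E := (Lp k I p).
Local Notation V := (higher_integrable [set` I] : set E).
Implicit Types (x y : E).

Let mI : measurable ([set` I] : set lebR).
Proof. by apply: measurable_lebR; exact: measurable_itv. Qed.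

Lemma exists_higher_integrable_neq0 : exists2 x, V x & x != 0.
Proof.
have m1 : modulus (real_scalar k (1 : R)) = 1 by rewrite modulus_real_scalar normr1.
have fi : p_integrable I p%:num (fun=> real_scalar k 1).
  apply/integrableP; split; first exact: measurable_cst.
  rewrite (_ : (fun t : lebR => _) = cst 1%E); last first.
    by apply/funext => t; rewrite /= m1 powR1 normr1.
  by rewrite (integral_cst mu mI) mul1e [ltLHS]mu_unit_itv ltry.
have fm : lebesgue_measurable [set` I] (fun=> real_scalar k (1 : R)).
  by apply: lebesgue_measurable_real_scalar; exact: measurable_cst.
have [x x1] := Lp_of_fun fm fi.
have ex q : energy [set` I] q x = 1%E.
  rewrite (energy_eq mI (@subset_refl _ _) x1); last exact: measurable_cst.
  rewrite [X in integral _ _ X](_ : _ = cst 1%E).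
    by rewrite (integral_cst mu mI) mul1e; exact: mu_unit_itv.
  by apply/funext => t; rewrite /= m1 powR1.
exists x; first by exists (p%:num + 1); [rewrite ltrDl|rewrite ex ltry].
apply/eqP => x0; have := energyZ mI (@subset_refl _ _) p%:num 0 x.
rewrite scale0r -[in LHS]x0 ex modulus0 powR0 ?gt_eqF// mul0e => /eqP.
by rewrite onee_eq0.
Qed.

Section Families.
Variables (T : Type) (alpha : set T).

Lemma lineable_Lp_only : alpha #<= [set: R] -> lineable alpha (@Lp_only R k p).
Proof.
move=> /card_subP[D Da _].
have iu := indep_mod_sub (@subsetT _ D) (@indep_geom R k p 0).
have sV := @subspaceV R k p.
exists (lin_span (geom k p 0 @` D)); split.
- exact: subspace_lin_span.
- have [B [hB BD]] := has_dim_indep_mod sV iu.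
  by exists B; split => //; exact: card_eq_trans BD _.
- move=> x [Fx /= x0]; apply/Lp_onlyE => Vx; apply: x0.
  exact: (span_indep_mod_cap iu).
Qed.

Lemma spaceable_finite : alpha #<= [set: R] -> finite_set alpha ->
  spaceable alpha [set: R] (@Lp_only R k p).
Proof.
move=> ac fa; split; first exact: lineable_Lp_only.
move=> F sF FA [B [[iB BF] Ba]].
have /finite_seqP[s0 Bs0] : finite_set B by rewrite (eq_finite_set Ba).
pose s := undup s0.
have us : uniq s := undup_uniq _.
have Fs : F = lin_span [set` s].
  rewrite -BF Bs0; congr lin_span; apply/seteqP.
  by split => x /=; rewrite mem_undup.
have FV : forall x, lin_span [set` s] x -> V x -> x = 0.
  by apply/sub_Lp_only0; rewrite -Fs.
have [i Fi] := finite_escape us FV.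
have sT := subspace_block_multiples k p i.
exists (add_lines s (block_multiples i)); split.
- exact: subspace_add_lines.
- apply/closed_gauge; apply: gauge_closed_add_lines => //.
  exact: closed_block_multiples.
- exact: has_dim_add_lines_block_multiples.
- rewrite Fs; apply: lin_span_sub; [exact: subspace_add_lines|exact: mem_add_lines].
- by apply/sub_Lp_only0; exact: add_lines_block_multiples_higher_integrable.
Qed.

(** A subspace meeting [V] only in [0] whose closure contains the nonzero element
    [one] of [V]. *)
Lemma not_spaceable_infinite : alpha #<= [set: R] -> infinite_set alpha ->
  ~ spaceable alpha [set: R] (@Lp_only R k p).
Proof.
move=> /card_subP[D Da _] /infiniteP na [_ sp].
have sV := @subspaceV R k p.
have [one one1 one0] := exists_higher_integrable_neq0.
have [idx] : $|{injfun [set: nat] >-> D}|.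
  apply/pcard_leP.
  apply: card_le_trans na _; have := card_esym Da.
  by rewrite card_eq_le => /andP[].
have iD n : D (idx n) by exact: (@funS _ _ _ _ idx n Logic.I).
have ii : injective idx by move=> n m; apply: inj; rewrite inE.
(* So that [geom 0 (idx n)] divided by [r n] has gauge at most [1 / (n + 1)]. *)
pose r n : R := (n.+1%:R * (gauge (geom k p 0 (idx n)) + 1)) `^ p%:num^-1.
have r0 n : 0 < r n.
  by rewrite powR_gt0// mulr_gt0// ltr_wpDl// gauge_ge0.
have /choice[lam lamP] : forall t, exists l : K,
    forall n, idx n = t -> l = real_scalar k (r n).
  move=> t; have [[n <-]|nt] := pselect (exists n, idx n = t).
    by exists (real_scalar k (r n)) => m /ii ->.
  by exists 0 => n nt'; case: nt; exists n.
pose u t := geom k p 0 t + lam t *: one.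
have iu : indep_mod V u D.
  apply: (indep_modD sV); first by move=> t _; exact: (subspaceZ sV _ one1).
  exact: indep_mod_sub (@subsetT _ D) (@indep_geom R k p 0).
pose F := lin_span (u @` D).
have FV : forall x, F x -> V x -> x = 0.
  by move=> x; exact: (span_indep_mod_cap iu).
have [Fb [sFb /closed_gauge cFb _ FFb /sub_Lp_only0 FbV]] : exists Fb : set E,
    [/\ vector_subspace Fb, closed Fb, has_dim Fb [set: R], F `<=` Fb &
      Fb `<=` @Lp_only R k p `|` [set 0]].
  apply: sp; first exact: subspace_lin_span.
    exact/sub_Lp_only0.
  have [B [hB BD]] := has_dim_indep_mod sV iu.
  by exists B; split => //; exact: card_eq_trans BD _.
move/eqP: one0; apply; apply: FbV => //; apply: cFb => e e0.
pose n := Num.truncn e^-1.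
exists (real_scalar k (r n)^-1 *: u (idx n)).
  apply: subspaceZ => //; apply: FFb; apply: sub_lin_span.
  by exists (idx n).
rewrite /u (lamP _ n erefl) scalerDr scalerA -real_scalarM.
rewrite mulVf ?lt0r_neq0// real_scalar1 scale1r addrK gaugeZ modulus_real_scalar.
set G := gauge _.
have G0 : 0 <= G by exact: gauge_ge0.
have G1 : 0 < n.+1%:R * (G + 1) by rewrite mulr_gt0// ltr_wpDl.
have -> : `|(r n)^-1| `^ p%:num = (n.+1%:R * (G + 1))^-1.
  rewrite ger0_norm ?invr_ge0 ?(ltW (r0 n))// -powR_inv1 ?(ltW (r0 n))//.
  rewrite -powRrM mulN1r powRN; congr (_^-1).
  by rewrite -powRrM mulVf ?lt0r_neq0// powRr1// ltW.
rewrite mulrC ltr_pdivrMr// mulrA; apply: (@lt_le_trans _ _ (G + 1)).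
  by rewrite ltrDl.
rewrite ler_peMl ?addr_ge0// -ler_pdivrMl// mulr1 ltW//.
by apply: lt_le_trans (truncnS_gt _) _; rewrite ler_nat.
Qed.

End Families.
End Main.

Theorem theorem3 (R : realType) (k : scalar_kind) (p : {posnum R})
    (T : Type) (alpha : set T) (alpha_le_c : alpha #<= [set: R]) :
  let I : interval R := `[0%R, 1%R] in
  spaceable alpha [set: R]
    ([set f : Lp k I p | (Lp_set k I p%:num `\`
       \bigcup_(q in [set q : R | p%:num < q]) Lp_set k I q) (Lp_val f)])
  <-> alpha #< [set: nat].
Proof.
rewrite /card_lt /=; split=> [sp|/andP[an nan]].
  have fa : finite_set alpha.
    by apply: contrapT => na; exact: (not_spaceable_infinite alpha_le_c na sp).
  apply/andP; split; first exact: finite_set_countable.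
  by apply/negP => /eq_finite_set e; apply: infinite_nat; rewrite -e.
apply: spaceable_finite => //; apply: contrapT => /infiniteP na.
by move/negP: nan; apply; rewrite card_eq_le an.
Qed.
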